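(* Let $\kappa$ be a regular uncountable cardinal, let $\mathcal{H}$ be a complex Hilbert space of dimension $\kappa$, and let $\mathcal{J}$ be the ideal in $\mathcal{B}(\mathcal{H})$ of operators whose range has dimension less than $\kappa$. If $2^{\kappa} = \kappa^{+}$, then the quotient C*-algebra $\mathcal{B}(\mathcal{H})/\mathcal{J}$ has $2^{\kappa^{+}}$-many outer automorphisms.
   Context: $\mathcal{B}(\mathcal{H})$ is the C*-algebra of bounded linear operators on $\mathcal{H}$. Dimension is Hilbert space dimension (cardinality of an orthonormal basis); the dimension of the range of an operator means the Hilbert space dimension of the closure of its range. For nonseparable $\mathcal{H}$, $\mathcal{J}$ is a norm-closed two-sided $*$-ideal of $\mathcal{B}(\mathcal{H})$. Automorphisms are $*$-automorphisms. An automorphism of a unital C*-algebra $A$ is inner if it is of the form $\mathrm{Ad}\,u : a \mapsto uau^*$ for some unitary $u \in A$, and outer otherwise. *)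

(* Defs.v *)
From HB Require Import structures.
From mathcomp Require Import all_boot all_order all_algebra generic_quotient.
From mathcomp Require Import all_real_closed wochoice.
From mathcomp Require Import all_classical all_reals all_analysis.

Set Implicit Arguments.
Unset Strict Implicit.
Unset Printing Implicit Defensive.

Import Order.TTheory GRing.Theory Num.Theory.
Import numFieldNormedType.Exports.
Local Open Scope classical_set_scope.
Local Open Scope quotient_scope.
Local Open Scope ring_scope.
Local Open Scope card_scope.

(** A cardinal is represented by a type of that cardinality; [2 ^ K] is then
    [set K]. *)

Definition card_lt T U (A : set T) (B : set U) : Prop :=
  A #<= B /\ ~ (B #<= A).

Definition uncountable (K : Type) : Prop := ~ countable [set: K].

Definition cofinal (K : Type) (r : rel K) (A : set K) : Prop :=
  forall x, exists2 y, A y & r x y.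

(** [(K, r)] has the order type of an initial ordinal. *)
Definition initial_order (K : Type) (r : rel K) : Prop :=
  well_order r /\ forall x, card_lt [set y | r y x /\ y <> x] [set: K].

(** The cardinal of [K] equals its cofinality.  Initial well-orders of [K] exist
    and are all isomorphic, so the choice of [r] is immaterial. *)
Definition regular_cardinal (K : Type) : Prop :=
  infinite_set [set: K] /\
  exists2 r : rel K, initial_order r &
    forall A : set K, cofinal r A -> A #= [set: K].

Definition successor_cardinal (K P : Type) : Prop :=
  card_lt [set: K] [set: P] /\
  forall T : Type, card_lt [set: K] [set: T] -> [set: P] #<= [set: T].

Section BoundedOperators.
Variables (C : numFieldType) (H : normedModType C).

Definition bounded_linear : {pred H -> H} := fun f =>
  `[< linear f /\ exists M : C, forall x, `|f x| <= M * `|x| >].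

Lemma bounded_linear_submod : submod_closed bounded_linear.
Proof.
split=> [|a f g /asboolP[lf [M fM]] /asboolP[lg [N gN]]]; apply/asboolP; split.
- by move=> a u v; rewrite scaler0 addr0.
- by exists 0 => x; rewrite normr0 mul0r.
- move=> b u v; change (a *: f (b *: u + v) + g (b *: u + v) =
    b *: (a *: f u + g u) + (a *: f v + g v)).
  by rewrite lf lg !scalerDr !scalerA (mulrC b a) addrACA.
exists (`|a| * M + N) => x; change (`|a *: f x + g x| <= (`|a| * M + N) * `|x|).
by rewrite (le_trans (ler_normD _ _))// normrZ mulrDl -mulrA lerD// ler_wpM2l.
Qed.

HB.instance Definition _ :=
  GRing.isSubmodClosed.Build C (H -> H) bounded_linear bounded_linear_submod.

Record bop := Bop { bop_fun :> H -> H; _ : bounded_linear bop_fun }.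

HB.instance Definition _ := [isSub for bop_fun].
HB.instance Definition _ := [Choice of bop by <:].
HB.instance Definition _ := [SubChoice_isSubLmodule of bop by <:].

Lemma bopP (S T : bop) : S =1 T -> S = T.
Proof. by move=> ST; apply/val_inj/funext. Qed.

Lemma bop_linear (T : bop) : linear T.
Proof. by case: T => f /= /asboolP[]. Qed.

Lemma bop_bounded (T : bop) : exists2 M : C, 0 <= M & forall x, `|T x| <= M * `|x|.
Proof.
case: T => f /= /asboolP[lf [M fM]]; have [x0|] := pselect (forall x : H, x = 0).
  by exists 0 => // x; rewrite (x0 (f x)) normr0 mul0r.
move=> /existsNP[x /eqP xN0]; exists M => //.
by have := le_trans (normr_ge0 _) (fM x); rewrite pmulr_lge0 ?normr_gt0.
Qed.

Lemma id_bounded_linear : bounded_linear id.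
Proof. by apply/asboolP; split=> //; exists 1 => x; rewrite mul1r. Qed.

Lemma comp_bounded_linear (S T : bop) : bounded_linear (S \o T).
Proof.
apply/asboolP; split=> [a u v /=|]; first by rewrite !bop_linear.
have [[M M0 SM] [N _ TN]] := (bop_bounded S, bop_bounded T).
by exists (M * N) => x /=; rewrite (le_trans (SM _))// -mulrA ler_wpM2l.
Qed.

Definition bop1 : bop := Bop id_bounded_linear.
Definition bop_comp (S T : bop) : bop := Bop (comp_bounded_linear S T).

Lemma bop_compA : associative bop_comp.
Proof. by move=> S T U; apply: bopP. Qed.

Lemma bop_comp1l : left_id bop1 bop_comp.
Proof. by move=> T; apply: bopP. Qed.

Lemma bop_comp1r : right_id bop1 bop_comp.
Proof. by move=> T; apply: bopP. Qed.

Lemma bop_compDl : left_distributive bop_comp +%R.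
Proof. by move=> S T U; apply: bopP. Qed.

Lemma bop_compDr : right_distributive bop_comp +%R.
Proof.
by move=> S T U; apply: bopP => x; have := bop_linear S 1 (T x) (U x); rewrite !scale1r.
Qed.

HB.instance Definition _ := GRing.Zmodule_isPzRing.Build bop
  bop_compA bop_comp1l bop_comp1r bop_compDl bop_compDr.

End BoundedOperators.

Section Hilbert.
Variables (R : realType) (H : completeNormedModType R[i]).
Variable dot : {dot H for Num.conj}.

Definition lspan (B : set H) : set H :=
  [set v | exists (s : seq H) (c : H -> R[i]),
    (forall x, x \in s -> B x) /\ v = \sum_(x <- s) c x *: x].

Definition orthonormal_set (B : set H) : Prop :=
  forall x y, B x -> B y -> dot x y = (x == y)%:R.

(** Only meaningful for [V] a closed subspace; then [V] is the closed linear
    span of [B]. *)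
Definition orthonormal_basis (V B : set H) : Prop :=
  [/\ B `<=` V, orthonormal_set B & V `<=` closure (lspan B)].

Definition hilbert_dim_eq (V : set H) (K : Type) : Prop :=
  exists2 B, orthonormal_basis V B & B #= [set: K].

Definition hilbert_dim_lt (V : set H) (K : Type) : Prop :=
  exists2 B, orthonormal_basis V B & card_lt B [set: K].

Definition small_ideal (K : Type) : set (bop H) :=
  [set T | hilbert_dim_lt (closure (range T)) K].

(** The adjoint exists, and is unique, by the Riesz representation theorem. *)
Definition adjoint (T : bop H) : bop H :=
  xget 0 [set S : bop H | forall x y, dot (T x) y = dot x (S y)].

Section Quotient.
Variable J : set (bop H).

Definition coset (T : bop H) : set (bop H) := [set S | J (S - T)].

Record quot := Quot { quot_set : set (bop H); _ : range coset quot_set }.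

Definition quot_pi (T : bop H) : quot :=
  Quot (ex_intro2 _ _ T I (erefl (coset T))).

Definition quot_repr (x : quot) : bop H :=
  xget 0 [set T | coset T = quot_set x].

Lemma quot_reprK : cancel quot_repr quot_pi.
Proof.
case=> A cA; have [T _ cT] := cA.
have e : coset (quot_repr (Quot cA)) = A.
  exact: (@xgetPex _ 0 [set T | coset T = A] (ex_intro _ T cT)).
rewrite /quot_pi; move: (ex_intro2 _ _ _ _ _).
by rewrite e => cA'; congr Quot; apply: Prop_irrelevance.
Qed.

HB.instance Definition _ := isQuotient.Build (bop H) quot quot_reprK.

(** The operations do not depend on the representatives when [J] is a two-sided
    *-ideal.  The quotient norm is omitted: *-automorphisms and unitaries only
    involve the *-algebra structure. *)
Definition quot_one : quot := \pi_quot (1 : bop H).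
Definition quot_add (x y : quot) : quot := \pi_quot (repr x + repr y).
Definition quot_mul (x y : quot) : quot := \pi_quot (repr x * repr y).
Definition quot_scale (a : R[i]) (x : quot) : quot := \pi_quot (a *: repr x).
Definition quot_star (x : quot) : quot := \pi_quot (adjoint (repr x)).

Definition star_automorphism (phi : quot -> quot) : Prop :=
  [/\ bijective phi,
      {morph phi : x y / quot_add x y},
      forall a, {morph phi : x / quot_scale a x},
      {morph phi : x y / quot_mul x y} &
      {morph phi : x / quot_star x}].

Definition unitary (u : quot) : Prop :=
  quot_mul u (quot_star u) = quot_one /\ quot_mul (quot_star u) u = quot_one.

Definition inner (phi : quot -> quot) : Prop :=
  exists2 u, unitary u &
    forall a, phi a = quot_mul (quot_mul u a) (quot_star u).

Definition outer_automorphism : set (quot -> quot) :=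
  [set phi | star_automorphism phi /\ ~ inner phi].

End Quotient.
End Hilbert.

Arguments outer_automorphism {R H} dot J.

(* Main.v *)
(** Fix an orthonormal basis [e] indexed by [K].  The rows and columns of
    the matrix of an operator have countable support, so, [K] being regular
    and uncountable, the matrix is supported on an equivalence relation with
    bounded classes; and an operator is in the ideal iff its matrix vanishes
    when the row index is large.  Hence, modulo the ideal, conjugating [T]
    by a diagonal sign unitary [diag((-1)^z)] only depends on the cocycle
    [(j, k) |-> z j (+) z k] on the equivalence relation of [T], near
    infinity.  Using [2 ^ K = K^+], enumerate the operators along a
    well-order [W] of type [K^+] and build an almost increasing sequence of
    equivalence relations with such cocycles, the [d]-th one containing the
    matrix of the [d]-th operator.  A diagonal-union argument passes through
    the limits, as these have at most [K] predecessors, and each step leaves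
    room for two extensions that differ on a permutation operator swapping
    unboundedly many pairs of basis vectors.  Conjugating each [T] by the
    signs of any late stage gives, for every branch of this binary tree of
    height [K^+], a *-automorphism, and distinct branches give distinct
    ones.  Only [K^+] automorphisms are inner. *)
Require Import Defs.
From HB Require Import structures.
From mathcomp Require Import all_boot all_order all_algebra finmap generic_quotient.
From mathcomp Require Import all_real_closed wochoice.
From mathcomp Require Import all_classical all_reals all_analysis.
From mathcomp Require Import ring.
Set Implicit Arguments.
Unset Strict Implicit.
Unset Printing Implicit Defensive.
Local Open Scope classical_set_scope.
Local Open Scope card_scope.

(** * Cardinals *)

Lemma card_le_inj T U (A : set T) (B : set U) (f : T -> U) :
  (forall x, A x -> B (f x)) ->
  (forall x y, A x -> A y -> f x = f y -> x = y) -> A #<= B.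
Proof.
move=> fAB finj; have [g] : $|{injfun A >-> B}|.
  apply/injfunPex; exists f => // x y; rewrite !inE; exact: finj.
exact: inj_card_le.
Qed.

Lemma card_le_ex T U (A : set T) (B : set U) : U -> A #<= B ->
  exists f : T -> U, (forall x, A x -> B (f x)) /\
    (forall x y, A x -> A y -> f x = f y -> x = y).
Proof.
move=> u; elim/Ppointed: U => U in B u *; first by have := no u.
move=> /pcard_leP/injfunPex[f fAB finj]; exists f; split=> // x y Ax Ay.
by apply: finj; rewrite inE.
Qed.

Lemma card_le_setTP T U :
  [set: T] #<= [set: U] <-> exists f : T -> U, injective f.
Proof.
split=> [TU|[f finj]]; last by apply: (card_le_inj (f := f)) => // x y _ _ /finj.
have [[u]|U0] := pselect (inhabited U).
  by have [f [_ fi]] := card_le_ex u TU; exists f => x y; exact: fi.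
have T0 (x : T) : Logic.False.
  by case/card_leP: TU => f; apply: U0; exists; exact: (set_val (f (SigSub (mem_set (I : [set: T] x))))).
by exists (fun x => False_rect U (T0 x)) => x; have := T0 x.
Qed.

Lemma card_le_set_type T (A : set T) :
  A #<= [set: {x | A x}] /\ [set: {x | A x}] #<= A.
Proof.
split; last first.
  apply: (card_le_inj (f := sval)) => [[x]//|[x Ax] [y Ay] _ _ /= e].
  exact: eq_exist.
have [[x0 Ax0]|A0] := pselect (exists x, A x); last first.
  have -> : A = set0 by apply/seteqP; split=> // x Ax; apply: A0; exists x.
  exact: card_ge0.
pose f x : {x | A x} := if pselect (A x) is left h then exist _ x h else exist _ x0 Ax0.
apply: (card_le_inj (f := f)) => // x y Ax Ay; rewrite /f.
by case: pselect => // ?; case: pselect => // ? [].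
Qed.

(** By Zorn's lemma there is a maximal graph of a partial injection between [X] and [Y]. It is total
    or onto, for otherwise a pair of missed points could be added. *)
Lemma card_le_total T U (A : set T) (B : set U) : A #<= B \/ B #<= A.
Proof.
suff typ (X Y : Type) : [set: X] #<= [set: Y] \/ [set: Y] #<= [set: X].
  have [A1 A2] := card_le_set_type A; have [B1 B2] := card_le_set_type B.
  have [h|h] := typ {x | A x} {x | B x}; [left|right].
    exact: (card_le_trans A1 (card_le_trans h B2)).
  exact: (card_le_trans B1 (card_le_trans h A2)).
pose P (G : set (X * Y)) := forall p q, G p -> G q -> (p.1 = q.1 <-> p.2 = q.2).
have [F FP tF|G [PG maxG]] := @Zorn_bigcup _ P.
  move=> p q [E FE Ep] [E' FE' Eq'].
  have [EE'|E'E] := tF _ _ FE FE'.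
    by apply: (FP _ FE') => //; exact: EE'.
  by apply: (FP _ FE) => //; exact: E'E.
have [domG|/existsNP[x xG]] := pselect (forall x, exists y, G (x, y)).
  left; apply/card_le_setTP; have [f fG] := choice domG.
  by exists f => x x' e; apply/(PG (x, f x) (x', f x')).
have [ranG|/existsNP[y yG]] := pselect (forall y, exists x, G (x, y)).
  right; apply/card_le_setTP; have [f fG] := choice ranG.
  by exists f => y y' e; apply/(PG (f y, y) (f y', y')).
exfalso; apply: (maxG (G `|` [set (x, y)])).
  split=> [p|/(_ (x, y))]; first by left.
  by move=> h; apply: xG; exists y; apply: h; right.
move=> [a b] [a' b'] [h|[-> ->]] [h'|[-> ->]] /=; last by [].
- exact: (PG (a, b) (a', b')).
- by split=> e; [case: xG; exists b; rewrite -e|case: yG; exists a; rewrite -e].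
- by split=> e; [case: xG; exists b'; rewrite e|case: yG; exists a'; rewrite e].
Qed.

(** * Hessenberg's theorem: the square of an infinite set injects into the set *)

Section Hessenberg.
Variable T : Type.

(* [G] is the graph of an injection from the square of its diagonal domain
   into that domain. *)
Let base (G : set (T * T * T)) := [set x | exists z, G (x, x, z)].
Let squaring (G : set (T * T * T)) :=
  [/\ forall p q, G p -> G q -> (p.1 = q.1 <-> p.2 = q.2),
      forall x y z, G (x, y, z) -> [/\ base G x, base G y & base G z] &
      forall x y, base G x -> base G y -> exists z, G (x, y, z)].

(** Zorn's lemma is applied to the [G] whose union with [G0] is squaring, so that the maximal graph
    obtained contains [G0]. *)
Lemma maximal_squaring G0 : squaring G0 ->
  exists G, [/\ squaring G, G0 `<=` G & forall G', squaring G' -> G `<=` G' -> G' = G].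
Proof.
move=> sG0.
have baseS (G G' : set (T * T * T)) : G `<=` G' -> base G `<=` base G'.
  by move=> GG' x [z /GG' ?]; exists z.
have [F FP tF|G [PG maxG]] := @Zorn_bigcup _ (fun G => squaring (G `|` G0)); last first.
  exists (G `|` G0); split=> // G' sG' GG'.
  apply: contrapT => ne; apply: (maxG G'); last first.
    by rewrite setUidl// => p G0p; apply: GG'; right.
  split=> [p Gp|G'G]; first by apply: GG'; left.
  by apply: ne; apply/seteqP; split=> // p /G'G; left.
set U := _ `|` G0.
(* Each squaring condition involves at most two points of the union, and any two points already lie
   in one squaring graph inside it. *)
pose stage p G := [/\ squaring G, G p & G `<=` U].
have stageP p : U p -> exists G, stage p G.
  move=> [[G FG Gp]|G0p]; last by exists G0; split=> // q; right.
  exists (G `|` G0); split; [exact: FP|by left|].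
  by move=> q [?|?]; [left; exists G|right].
have stage2 p q : U p -> U q -> exists G, stage p G /\ stage q G.
  have FU G : F G -> G `|` G0 `<=` U by move=> FG r [?|?]; [left; exists G|right].
  move=> [[G FG Gp]|G0p] [[G' FG' Gq]|G0q].
  - have [GG'|G'G] := tF _ _ FG FG'.
      by exists (G' `|` G0); split; split; [exact: FP|left; exact: GG'|exact: FU|
        exact: FP|left|exact: FU].
    by exists (G `|` G0); split; split; [exact: FP|left|exact: FU|
      exact: FP|left; exact: G'G|exact: FU].
  - by exists (G `|` G0); split; split; [exact: FP|left|exact: FU|exact: FP|right|exact: FU].
  - by exists (G' `|` G0); split; split; [exact: FP|right|exact: FU|exact: FP|left|exact: FU].
  - by exists G0; split; split=> // r; right.
split.
- by move=> p q Up Uq; have [G [[[sG _ _] Gp _] [_ Gq _]]] := stage2 p q Up Uq; exact: sG.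
- move=> x y z /stageP[G [[_ sG _] /sG[bx b_y bz] GU]].
  by split; apply: baseS GU _ _.
- move=> x y [z Uz] [z' Uz'].
  have [G [[[_ _ sG] Gx GU] [_ Gy _]]] := stage2 _ _ Uz Uz'.
  by have [||w Gw] := sG x y; [exists z|exists z'|exists w; exact: GU].
Qed.

(** Let [A] be the base of a maximal squaring graph extending one on a copy of [nat]. If the
    complement of [A] embeds in [A], so does [T], and the pairing on [A] suffices. Otherwise [A] has
    a copy outside [A], over which the graph can be extended, against maximality. *)
Lemma card_square : infinite_set [set: T] -> [set: T * T] #<= [set: T].
Proof.
move=> /infiniteP natT.
have [[t0]|T0] := pselect (inhabited T); last first.
  by apply: (card_le_inj (f := fst)) => // -[x]; case: T0; exists.
have [e [_ einj]] := card_le_ex t0 natT.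
have {}einj : injective e by move=> m n; exact: einj.
have /card_le_setTP[c cinj] : [set: nat * nat] #<= [set: nat].
  by rewrite (card_le_eql card_nat2).
pose G0 : set (T * T * T) := [set p | exists m n, p = (e m, e n, e (c (m, n)))].
have base0 n : base G0 (e n) by exists (e (c (n, n))), n, n.
have sG0 : squaring G0.
  split.
  - move=> p q [m [n ->]] [m' [n' ->]] /=; split=> [[/einj-> /einj->]//|].
    by move=> /einj/cinj[-> ->].
  - by move=> x y z [m [n [-> -> ->]]].
  - by move=> x y [z [m [_ [-> _ _]]]] [z' [n [_ [-> _ _]]]]; exists (e (c (m, n))), m, n.
have [G [[Ginj Gb Gtot] G0G Gmax]] := maximal_squaring sG0.
pose A := base G; have Ae n : A (e n) by have [z /G0G] := base0 n; exists z.
have /choice[f' f'G] (p : T * T) : exists z, A p.1 -> A p.2 -> G (p, z).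
  case: p => x y /=; have [[Ax Ay]|nA] := pselect (A x /\ A y).
    by have [z] := Gtot x y Ax Ay; exists z.
  by exists t0 => Ax Ay; case: nA.
have [f fG] : exists f : T * T -> T, forall x y, A x -> A y -> G (x, y, f (x, y)).
  by exists f' => x y; exact: (f'G (x, y)).
have fA x y : A x -> A y -> A (f (x, y)) by move=> Ax Ay; have [] := Gb _ _ _ (fG x y Ax Ay).
have finj x y x' y' : A x -> A y -> A x' -> A y' -> f (x, y) = f (x', y') -> x = x' /\ y = y'.
  by move=> Ax Ay Ax' Ay' /(Ginj _ _ (fG x y Ax Ay) (fG x' y' Ax' Ay'))[].
suff [h [hA hinj]] : exists h : T -> T, (forall x, A (h x)) /\ injective h.
  apply/card_le_setTP; exists (fun p => f (h p.1, h p.2)) => -[x y] [x' y'] /= E.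
  by have [//|//|//|//|/hinj-> /hinj->] := finj _ _ _ _ _ _ _ _ E.
have [CA|AC] := card_le_total (~` A) A.
  have [g [gA ginj]] := card_le_ex t0 CA.
  (* The tags [e 0] and [e 1] keep the two pieces of [T] apart inside [A]. *)
  exists (fun x => if pselect (A x) then f (e 0, x) else f (e 1, g x)); split.
    by move=> x; case: pselect => h; apply: fA => //; exact: gA.
  move=> x y; case: pselect => hx; case: pselect => hy.
  - by move=> E; have [] := finj _ _ _ _ _ _ _ _ E.
  - by move=> E; have [//|//|//||/einj//] := finj _ _ _ _ _ _ _ _ E; exact: gA.
  - by move=> E; have [//||//|//|/einj//] := finj _ _ _ _ _ _ _ _ E; exact: gA.
  - by move=> E; have [//||//||_ /ginj->//] := finj _ _ _ _ _ _ _ _ E; exact: gA.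
have [g [gA ginj]] := card_le_ex t0 AC.
have gNA x : A x -> A (g x) -> Logic.False by move=> Ax; exact: gA.
pose B := [set x | exists2 y, A y & x = g y].
exfalso.
pose tagged (s : bool) x := if s then g x else x.
have tinj s s' x x' : A x -> A x' -> tagged s x = tagged s' x' -> s = s' /\ x = x'.
  case: s; case: s' => //= Ax Ax' E.
  - by split=> //; exact: ginj.
  - by case: (gNA x) => //; rewrite E.
  - by case: (gNA x') => //; rewrite -E.
pose num (s s' : bool) : nat := (s + s'.*2)%N.
have numinj s s' t t' : num s s' = num t t' -> s = t /\ s' = t'.
  by case: s; case: s'; case: t; case: t'.
(* Pairs from [A] keep their old code, so that the new graph extends [G]. The three other kinds of
   pairs are coded in the copy of [A] under [g], with [num] recording the kind. *)
pose code s s' x y := if s || s' then g (f (f (x, y), e (num s s'))) else f (x, y).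
have fAe s s' x y : A x -> A y -> A (f (f (x, y), e (num s s'))).
  by move=> Ax Ay; apply: (fA) => //; exact: fA.
have codeinj s s' x y t t' z w : A x -> A y -> A z -> A w ->
    code s s' x y = code t t' z w -> [/\ s = t, s' = t', x = z & y = w].
  move=> Ax Ay Az Aw; rewrite /code.
  have [hs|hs] := boolP (s || s'); have [ht|ht] := boolP (t || t').
  - move=> /ginj E.
    have /finj [||||/finj[]// -> ->] := E (fAe _ _ _ _ Ax Ay) (fAe _ _ _ _ Az Aw) => //.
    - exact: fA.
    - exact: fA.
    - by move/einj/numinj => [-> ->].
  - move=> E; case: (gNA _ (fAe s s' x y Ax Ay)).
    by rewrite E; exact: fA.
  - move=> E; case: (gNA _ (fAe t t' z w Az Aw)).
    by rewrite -E; exact: fA.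
  - move=> /finj[]// -> ->; move: hs ht.
    by case: (s); case: (s'); case: (t); case: (t').
pose G' := [set p | exists s s' x y, [/\ A x, A y &
  p = (tagged s x, tagged s' y, code s s' x y)]].
have baseG' s x : A x -> base G' (tagged s x).
  by move=> Ax; exists (code s s x x), s, s, x, x.
have baseG'E x : base G' x -> exists s y, A y /\ x = tagged s y.
  by move=> [z [s [s' [a [b [Aa Ab [-> _ _]]]]]]]; exists s, a.
have G'G : G' = G.
  apply: Gmax.
    split.
    - move=> p q [s [s' [x [y [Ax Ay ->]]]]] [t [t' [z [w [Az Aw ->]]]]] /=.
      split=> [[/tinj[//|//|-> ->] /tinj[//|//|-> ->]]//|].
      by move=> /codeinj[]// -> -> -> ->.
    - move=> _ _ _ [s [s' [x [y [Ax Ay [-> -> ->]]]]]]; split; [exact: baseG'|exact: baseG'|].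
      rewrite /code; case: ifP => _; first by apply: (baseG' true); exact: fAe.
      by apply: (baseG' false); exact: fA.
    - move=> x y /baseG'E[s [x' [Ax ->]]] /baseG'E[s' [y' [Ay ->]]].
      by exists (code s s' x' y'), s, s', x', y'.
  move=> [[x y] z] Gxyz; have [Ax Ay Az] := Gb _ _ _ Gxyz.
  exists false, false, x, y; split=> //=; congr (_, _, _).
  by apply/(Ginj _ _ Gxyz (fG x y Ax Ay)).
case: (gNA (e 0)) => //.
by have := baseG' true (e 0) (Ae 0); rewrite /= G'G.
Qed.

End Hessenberg.

(** * Bounded sets in a regular well-order *)

Section WellOrder.
Variables (T : Type) (r : rel T).
Hypothesis wo : well_order r.

(** [well_order] only provides unique least elements of nonempty sets; the order axioms are read off
    from sets of at most three points. *)
Let min2 (x y : T) : exists2 z, z = x \/ z = y & r z x /\ r z y.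
Proof.
have [|z [[]]] := wo (A := [pred z | `[< z = x \/ z = y >]]).
  by exists x; apply/asboolP; left.
by move=> /asboolP zxy lb _; exists z => //; split; apply: lb; apply/asboolP; [left|right].
Qed.

Lemma wo_refl : reflexive r.
Proof. by move=> x; have [z [->|->] []] := min2 x x. Qed.

Lemma wo_total : total r.
Proof. by move=> x y; have [z [->|->] [? ?]] := min2 x y; apply/orP; [left|right]. Qed.

Lemma wo_anti : antisymmetric r.
Proof.
move=> x y /andP[xy yx].
have [|z [_ uz]] := wo (A := [pred z | `[< z = x \/ z = y >]]).
  by exists x; apply/asboolP; left.
rewrite -(uz x) ?(uz y)//; split; try by apply/asboolP; (left + right).
  by move=> t /asboolP[]->//; exact: wo_refl.
by move=> t /asboolP[]->//; exact: wo_refl.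
Qed.

Lemma wo_least (P : T -> Prop) : (exists x, P x) ->
  exists2 x, P x & forall y, P y -> r x y.
Proof.
move=> [x Px]; have [|z [[/asboolP Pz lb] _]] := wo (A := [pred z | `[< P z >]]).
  by exists x; apply/asboolP.
by exists z => // y Py; apply: lb; apply/asboolP.
Qed.

Lemma wo_trans : transitive r.
Proof.
move=> y x z xy yz.
have [t [->|[->|->]] lb] := @wo_least (fun t => t = x \/ t = y \/ t = z) (ex_intro _ x (or_introl erefl)).
- by apply: lb; right; right.
- by rewrite (@wo_anti x y)// xy lb//; left.
- by rewrite -(@wo_anti y z) ?yz ?lb//; right; left.
Qed.

Lemma wo_ltW x y : ~~ r y x -> r x y.
Proof. by have /orP[->|->] := wo_total x y. Qed.

Lemma wo_lt_le x y z : ~~ r y x -> r y z -> ~~ r z x.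
Proof. by move=> xy yz; apply: contra xy; exact: wo_trans. Qed.

Lemma wo_le_lt x y z : r x y -> ~~ r z y -> ~~ r z x.
Proof. by move=> xy; apply: contra => zx; exact: wo_trans xy. Qed.

Lemma wo_lt_wf : well_founded (fun x y => ~~ r y x).
Proof.
move=> x; apply: contrapT => nx.
have [z nz lb] := wo_least (ex_intro (fun x => ~ Acc _ x) x nx).
apply: nz; constructor=> y yz; apply: contrapT => /lb zy.
by rewrite zy in yz.
Qed.

Lemma wo_max2 x y : exists z, r x z /\ r y z.
Proof. by have /orP[h|h] := wo_total x y; [exists y|exists x]; rewrite h wo_refl. Qed.

End WellOrder.

(** A choice function is applied to classes as sets: by extensionality, equivalent points have the
    same class and so the same representative. *)
Lemma equivalence_representative T (E : T -> T -> Prop) : (forall x, E x x) ->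
  (forall x y, E x y -> E y x) -> (forall x y z, E x y -> E y z -> E x z) ->
  exists p : T -> T, (forall x, E x (p x)) /\ (forall x y, E x y -> p x = p y).
Proof.
move=> Er Es Et.
have [[t]|T0] := pselect (inhabited T); last first.
  by exists id; split=> x; case: T0; exists.
have /choice[c cP] (A : set T) : exists x, (exists y, A y) -> A x.
  by have [[x Ax]|nA] := pselect (exists x, A x); [exists x|exists t => /nA].
exists (fun x => c (E x)); split=> [x|x y Exy]; first by apply: cP; exists x; exact: Er.
congr c; apply/seteqP; split=> z; [exact/Et/Es|exact: Et].
Qed.

Section Regular.
Variables (K : Type) (r : rel K).
Hypothesis wo : well_order r.
Hypothesis initial : forall x, card_lt [set y | r y x /\ y <> x] [set: K].
Hypothesis regular : forall A : set K, cofinal r A -> A #= [set: K].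
Hypothesis infinK : infinite_set [set: K].
Hypothesis uncK : uncountable K.

Local Notation "x '≺' y" := (~~ r y x) (at level 70).

Definition order_bounded (A : set K) := exists x, forall y, A y -> y ≺ x.

(** Regularity enters here, since an unbounded set is cofinal. *)
Lemma unbounded_card (A : set K) : ~ order_bounded A -> [set: K] #<= A.
Proof.
move=> nb; suff /regular : cofinal r A by rewrite card_eq_le => /andP[].
move=> x; apply: contrapT => nx; apply: nb; exists x => y Ay.
by apply/negP => xy; apply: nx; exists y.
Qed.

Lemma bounded_card (A : set K) : order_bounded A -> ~ ([set: K] #<= A).
Proof.
move=> [x xA] KA; have [_] := initial x; apply.
apply: (card_le_trans KA); apply: subset_card_le => y /xA yx.
by split; [exact: wo_ltW|move=> e; rewrite e wo_refl in yx].
Qed.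

Lemma order_boundedS (A B : set K) : A `<=` B -> order_bounded B -> order_bounded A.
Proof. by move=> AB [x xB]; exists x => y /AB/xB. Qed.

Lemma small_bounded I (D : set I) (A : set K) :
  ~ ([set: K] #<= D) -> A #<= D -> order_bounded A.
Proof.
by move=> KD AD; apply: contrapT => /unbounded_card KA; apply/KD/(card_le_trans KA).
Qed.

Lemma countable_small I (D : set I) : countable D -> ~ ([set: K] #<= D).
Proof. by move=> cD KD; apply/uncK/(card_le_trans KD). Qed.

Lemma finite_small I (D : set I) : finite_set D -> ~ ([set: K] #<= D).
Proof. by move=> fD KD; apply/infinK/(card_le_finite KD). Qed.

Lemma order_bounded1 x : order_bounded [set x].
Proof. exact: small_bounded (finite_small (finite_set1 x)) (card_lexx _). Qed.

Lemma exists_gt x : exists y, x ≺ y.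
Proof. by have [y xy] := order_bounded1 x; exists y; exact: xy. Qed.

Lemma bounded_le x : order_bounded [set y | r y x].
Proof.
have [z xz] := exists_gt x; exists z => y /= yx; exact: (wo_le_lt wo) yx xz.
Qed.

(** Strict bounds of the sets [F i] can be chosen to form a set of fewer than [K] points, which is
    itself bounded. *)
Lemma bounded_bigcup I (D : set I) (F : I -> set K) : ~ ([set: K] #<= D) ->
  (forall i, D i -> order_bounded (F i)) -> order_bounded (\bigcup_(i in D) F i).
Proof.
move=> KD bF; have /choice[g gF] i : exists x, D i -> forall y, F i y -> y ≺ x.
  have [/bF[x xF]|nD] := pselect (D i); first by exists x.
  by have [k _] := infinite_setN0 infinK; exists k => /nD.
have [x xg] := small_bounded KD (card_image_le g D).
exists x => y [i Di Fiy]; apply: (wo_lt_le wo) (gF i Di y Fiy) _.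
by apply: wo_ltW => //; apply: xg; exists i.
Qed.

Lemma order_boundedU (A B : set K) :
  order_bounded A -> order_bounded B -> order_bounded (A `|` B).
Proof.
move=> [x xA] [y yB]; have [z [xz yz]] := wo_max2 wo x y.
by exists z => t [/xA tx|/yB ty]; [exact: (wo_lt_le wo) tx xz|exact: (wo_lt_le wo) ty yz].
Qed.

Lemma bounded_preimage T (f : T -> K) (A : set T) (B : set K) :
  (forall x y, A x -> A y -> f x = f y -> x = y) -> order_bounded B ->
  ~ ([set: K] #<= A `&` f @^-1` B).
Proof.
move=> finj bB KA; apply: (bounded_card bB); apply: (card_le_trans KA).
by apply: (card_le_inj (f := f)) => [x []//|x y [Ax _] [Ay _]]; exact: finj.
Qed.

(** Iterate from [x] a function [g] that bounds the [R]-successors of all points up to its argument.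
    The orbit is countable, hence bounded, and its supremum [d] works: a point below [d] is below
    some [s n], and its successors are below [s n.+1]. *)
Lemma closure_point (R : K -> K -> Prop) : (forall x, order_bounded (R x)) ->
  forall x, exists2 d, x ≺ d & forall b y, b ≺ d -> R b y -> y ≺ d.
Proof.
move=> bR x.
have /choice[g gP] z : exists g, z ≺ g /\ forall b y, r b z -> R b y -> y ≺ g.
  have [g gP] := order_boundedU (order_bounded1 z)
    (bounded_bigcup (bounded_card (bounded_le z)) (fun b _ => bR b)).
  exists g; split=> [|b y bz Rby]; first by apply: gP; left.
  by apply: gP; right; exists b.
pose s n := iter n g x.
have [u us] := small_bounded (countable_small (countableP [set: nat]))
  (card_image_le s [set: nat]).
have [d sd ld] := wo_least wo (ex_intro (fun d => forall n, s n ≺ d) u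
  (fun n => us _ (ex_intro2 _ _ n I erefl))).
exists d => [|b y bd Rby]; first exact: (sd 0).
have [n bn] : exists n, r b (s n).
  apply: contrapT => nb; move: bd; rewrite ld// => n.
  by apply/negP => bs; apply: nb; exists n.
by apply: (wo_lt_le wo) (wo_ltW wo (sd n.+1)); have [_] := gP (s n); apply; first exact: bn.
Qed.

(** Two points are identified when no closure point of the symmetrised relation separates them.
    Classes are bounded because there is a closure point above any given point. *)
Lemma equivalence_hull (R : K -> K -> Prop) :
  (forall x, order_bounded (R x)) -> (forall y, order_bounded (R^~ y)) ->
  exists E : K -> K -> Prop, [/\ forall x y, R x y -> E x y, forall x, E x x,
    forall x y, E x y -> E y x, forall x y z, E x y -> E y z -> E x z &
    forall x, order_bounded (E x)].
Proof.
move=> bR bR'; pose S x y := R x y \/ R y x.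
have bS x : order_bounded (S x) by exact: order_boundedU.
pose D d := forall b y, b ≺ d -> S b y -> y ≺ d.
exists (fun x y => forall d, D d -> (x ≺ d <-> y ≺ d)); split.
- by move=> x y Rxy d Dd; split=> h; apply: Dd h _; [left|right].
- by [].
- by move=> x y E d Dd; rewrite E.
- by move=> x y z E E' d Dd; rewrite E// E'.
- move=> x; have [d xd Dd] := closure_point bS x.
  by exists d => y /(_ d Dd)[+ _]; apply.
Qed.

(** Twisting signs by [w] is invisible on [E], where [w] is constant on classes, but changes the
    relative sign of [y] and [s y] arbitrarily far out. There are [K] many classes; [s] swaps paired
    representatives of distinct classes, and [w] marks one class of each pair. *)
Lemma equivalence_splitting (E : K -> K -> Prop) : (forall x, E x x) ->
  (forall x y, E x y -> E y x) -> (forall x y z, E x y -> E y z -> E x z) ->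
  (forall x, order_bounded (E x)) ->
  exists (w : K -> bool) (s : K -> K), [/\ forall x y, E x y -> w x = w y,
    involutive s & forall x, exists y, [/\ r x y, r x (s y) & w (s y) != w y]].
Proof.
move=> Er Es Et bE; have [p [Ep pE]] := equivalence_representative Er Es Et.
have pp x : p (p x) = p x by rewrite -(pE _ _ (Ep x)).
have [k _] := infinite_setN0 infinK.
(* With a bounded set of representatives, [K] would be a union of fewer than [K] bounded classes. *)
have Kp : [set: K] #<= range p.
  apply: unbounded_card => bp.
  have := bounded_bigcup (bounded_card bp) (fun i _ => bE i).
  move=> /bounded_card; apply; apply: subset_card_le => x _.
  by exists (p x); [exists x|exact/Es].
have [h [hp hinj]] := card_le_ex k Kp.
have /card_le_setTP[j jinj] := card_square infinK.
have [a [b ab]] : exists a b : K, a <> b.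
  by have [b ab] := exists_gt k; exists k, b => e; rewrite -e wo_refl in ab.
(* A family of distinct representatives indexed by [K] times [bool], the second factor being coded
   by [a] and [b]. *)
pose u x (c : bool) := h (j (x, if c then a else b)).
have uinj x c y c' : u x c = u y c' -> x = y /\ c = c'.
  by move=> /hinj-/(_ I I)/jinj[-> e]; split=> //; case: (c) (c') e => -[]// e; case: ab.
have pu x c : p (u x c) = u x c by rewrite /u; have [y _ <-] := hp (j (x, if c then a else b)) I.
pose w y := `[< exists x, p y = u x true >].
have wu x c : w (u x c) = c.
  rewrite /w pu; apply/asboolP/idP => [[y /uinj[_ ->]]//|->]; by exists x.
have /choice[s sP] y : exists z, (forall x c, y = u x c -> z = u x (~~ c)) /\
    ((forall x c, y <> u x c) -> z = y).
  have [[x [c ->]]|nu] := pselect (exists x c, y = u x c).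
    exists (u x (~~ c)); split=> [x' c' /uinj[-> ->]//|/(_ x c)].
    by [].
  exists y; split=> // x c yu; by case: nu; exists x, c.
have su x c : s (u x c) = u x (~~ c) by have [+ _] := sP (u x c); apply.
exists w, s; split.
- by move=> x y /pE pxy; rewrite /w pxy.
- move=> y; have [[x [c ->]]|nu] := pselect (exists x c, y = u x c).
    by rewrite !su negbK.
  have sy : s y = y by have [_] := sP y; apply=> x c yu; case: nu; exists x, c.
  by rewrite !sy.
(* By injectivity of [u], only a bounded set of indices gives a representative below [x]; [z] avoids
   it for both values of [c]. *)
- move=> x; have bx : order_bounded [set y | y ≺ x] by exists x.
  have small c : order_bounded [set y | u y c ≺ x].
    apply: (small_bounded _ (card_lexx _)).
    have := @bounded_preimage _ (u ^~ c) setT _ _ bx.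
    by rewrite setTI; apply => y z _ _ /uinj[].
  have [z zP] := order_boundedU (small true) (small false).
  have xu c : r x (u z c).
    apply: contrapT => /negP nx; have := wo_refl wo z; apply/negP/zP.
    by case: c nx; [left|right].
  by exists (u z false); rewrite su !wu; split=> //; exact: xu.
Qed.

End Regular.

(** * Signed equivalence relations *)

Section SignedRelations.
Variables (K : Type) (r : rel K).
Hypothesis wo : well_order r.
Hypothesis initial : forall x, card_lt [set y | r y x /\ y <> x] [set: K].
Hypothesis regular : forall A : set K, cofinal r A -> A #= [set: K].
Hypothesis infinK : infinite_set [set: K].
Hypothesis uncK : uncountable K.

Local Notation "x '≺' y" := (~~ r y x) (at level 70).
Local Notation order_bounded := (order_bounded r).

Definition signed_rel := K -> K -> bool -> Prop.

(** [S x y b] says that [x] and [y] are equivalent and that the signs at [x] and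
    [y] of the diagonal unitary differ iff [b]. *)
Record signed_equivalence (S : signed_rel) : Prop := SignedEquivalence {
  signed_refl : forall x, S x x false;
  signed_sym : forall x y b, S x y b -> S y x b;
  signed_trans : forall x y z b c, S x y b -> S y z c -> S x z (b (+) c);
  signed_fun : forall x y b c, S x y b -> S x y c -> b = c;
  signed_bounded : forall x, order_bounded [set y | exists b, S x y b] }.

(** Both indices are taken beyond [a] because an operator whose matrix vanishes on such pairs is in
    the ideal. *)
Definition subrel_beyond a (S S' : signed_rel) :=
  forall x y b, r a x -> r a y -> S x y b -> S' x y b.

Definition almost_subrel S S' := exists a, subrel_beyond a S S'.

Lemma almost_subrel_refl S : almost_subrel S S.
Proof. by have [x _] := infinite_setN0 infinK; exists x. Qed.

(** [z x] is the relative sign of [x] and the chosen representative of its class, so every such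
    cocycle is a coboundary. *)
Lemma signed_trivialization S : signed_equivalence S ->
  exists z : K -> bool, forall x y b, S x y b -> b = z x (+) z y.
Proof.
move=> [Sr Ss St Sf _].
have [||x y z [b xy] [c yz]|p [Sp pS]] :=
    @equivalence_representative _ (fun x y => exists b, S x y b).
- by move=> x; exists false.
- by move=> x y [b xy]; exists b; exact: Ss.
- by exists (b (+) c); exact: St xy yz.
have /choice[z zS] := Sp; exists z => x y b xy.
have e : p x = p y by apply: pS; exists b.
apply: Sf xy _; apply: St (zS x) _; rewrite e; exact/Ss/zS.
Qed.

(** The diagonal union: [S i] is put to use only beyond closure points above [h i]. Thus fewer than
    [K] relations are in use at a given point, and those in use are pairwise comparable there
    without any further error. *)
Lemma signed_amalgam I (A : set I) (h : I -> K) (S : I -> signed_rel) :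
  (forall i j, A i -> A j -> h i = h j -> i = j) ->
  (forall i, A i -> signed_equivalence (S i)) ->
  (forall i j, A i -> A j -> almost_subrel (S i) (S j) \/ almost_subrel (S j) (S i)) ->
  exists S', signed_equivalence S' /\ forall i, A i -> almost_subrel (S i) S'.
Proof.
move=> hinj seS tS.
have /choice[g gP] (p : I * I) : exists a, A p.1 -> A p.2 ->
    subrel_beyond a (S p.1) (S p.2) \/ subrel_beyond a (S p.2) (S p.1).
  have [[A1 A2]|nA] := pselect (A p.1 /\ A p.2).
    by have [[a h1]|[a h1]] := tS _ _ A1 A2; exists a => _ _; [left|right].
  by have [a _] := infinite_setN0 infinK; exists a => A1 A2; case: nA.
pose below m := A `&` h @^-1` [set y | r y m].
have small m : ~ ([set: K] #<= below m).
  exact: (bounded_preimage wo initial hinj (bounded_le wo regular infinK m)).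
(* If [d] is a closure point of [R], then no class of [S i] with [h i < d]
   crosses [d], and any two such [S i] are comparable beyond [d]. *)
pose R m y := (exists i n b, [/\ below m i, r n m & S i n y b]) \/
  exists i j, [/\ below m i, below m j & y = g (i, j)].
have bR m : order_bounded (R m).
  have bU := bounded_bigcup wo regular infinK.
  apply: (@order_boundedS _ r _ ((\bigcup_(i in below m) \bigcup_(n in [set n | r n m])
    [set y | exists b, S i n y b]) `|`
    \bigcup_(i in below m) \bigcup_(j in below m) [set g (i, j)])).
    move=> y [[i [n [b [bi nm Sn]]]]|[i [j [bi bj ->]]]]; [left|right]; exists i => //.
      by exists n => //; exists b.
    by exists j.
  apply: order_boundedU => //; apply: (bU) => // i [Ai _].
    apply: (bU) => [|n _]; last exact: signed_bounded (seS _ Ai) n.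
    exact: (bounded_card wo initial (bounded_le wo regular infinK m)).
  by apply: (bU) => // j _; exact: order_bounded1.
pose D d := forall b y, b ≺ d -> R b y -> y ≺ d.
have unbD x : exists2 d, x ≺ d & D d by exact: closure_point.
have Dclass d i x y b : D d -> A i -> h i ≺ d -> x ≺ d -> S i x y b -> y ≺ d.
  move=> Dd Ai hid xd Sxy; have [m [[hm xm] md]] : exists m, (r (h i) m /\ r x m) /\ m ≺ d.
    have /orP[hx|xh] := wo_total wo (h i) x; first by exists x; rewrite hx wo_refl.
    by exists (h i); rewrite xh wo_refl.
  by apply: Dd md _; left; exists i, x, b.
have Dtot d i j : D d -> A i -> A j -> h i ≺ d -> h j ≺ d ->
    subrel_beyond d (S i) (S j) \/ subrel_beyond d (S j) (S i).
  move=> Dd Ai Aj hi hj.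
  have gd : g (i, j) ≺ d.
    have [m [[im jm] md]] : exists m, (r (h i) m /\ r (h j) m) /\ m ≺ d.
      have /orP[hx|xh] := wo_total wo (h i) (h j); first by exists (h j); rewrite hx wo_refl.
      by exists (h i); rewrite xh wo_refl.
    by apply: Dd md _; right; exists i, j.
  have gdx x : r d x -> r (g (i, j)) x by move=> dx; exact: (wo_trans wo) (wo_ltW wo gd) dx.
  have [] := gP (i, j) Ai Aj => h1; [left|right] => x y b dx dy;
    by apply: h1; exact: gdx.
(* [ok d i x] says that [S i] is in use at [x], as witnessed by the closure point [d]. *)
pose ok d i x := [/\ D d, A i, h i ≺ d & r d x].
have okS d i x y b : ok d i x -> S i x y b -> ok d i y.
  move=> [Dd Ai hi dx] Sxy; split=> //; apply: contrapT => /negP yd.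
  have := Dclass d i y x b Dd Ai hi yd (signed_sym (seS _ Ai) Sxy).
  by rewrite dx.
(* Beyond the larger of the two closure points one relation contains the other, and the classes of
   [x] stay beyond it. The larger relation thus serves for both, which gives transitivity of the
   union. *)
have merge x d i d' i' : ok d i x -> ok d' i' x -> exists j e, [/\ ok e j x,
    forall y b, S i x y b -> S j x y b & forall y b, S i' x y b -> S j x y b].
  move=> o o'; have [Dd Ai hi dx] := o; have [Dd' Ai' hi' dx'] := o'.
  wlog dd' : d d' i i' o o' Dd Ai hi dx Dd' Ai' hi' dx' / r d d'.
    move=> W; have /orP[h1|h1] := wo_total wo d d'; first exact: (W d d' i i').
    by have [j [e [? ? ?]]] := W d' d i' i o' o Dd' Ai' hi' dx' Dd Ai hi dx h1; exists j, e.
  have hid' : h i ≺ d' by exact: (wo_lt_le wo) hi dd'.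
  have ok1 : ok d' i x by [].
  have [h1|h1] := Dtot d' i i' Dd' Ai Ai' hid' hi'.
    exists i', d'; split=> // y b Sy; apply: h1 => //.
    by have [] := okS _ _ _ _ _ ok1 Sy.
  exists i, d'; split=> // y b Sy; apply: h1 => //.
  by have [] := okS _ _ _ _ _ o' Sy.
(* The diagonal is added for the points at which no relation is in use. *)
pose S' x y b := (x = y /\ b = false) \/ exists i d, ok d i x /\ S i x y b.
exists S'; split; last first.
  move=> i Ai; have [d hd Dd] := unbD (h i); exists d => x y b dx dy Sxy.
  by right; exists i, d.
have S'trans x y z b c : S' x y b -> S' y z c -> S' x z (b (+) c).
  move=> [[<- ->]//|[i [d [ox Sxy]]]] [[<- ->]|[i' [d' [oy' Syz]]]].
    by rewrite addbF; right; exists i, d.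
  have oy := okS _ _ _ _ _ ox Sxy.
  have [_ Ai _ _] := ox.
  have [j [e [oj Si Si']]] := merge y d i d' i' oy oy'.
  have [_ Aj _ _] := oj.
  have Sjyx := Si _ _ (signed_sym (seS _ Ai) Sxy).
  right; exists j, e; split; first exact: okS oj Sjyx.
  exact: (signed_trans (seS _ Aj) (signed_sym (seS _ Aj) Sjyx) (Si' _ _ Syz)).
split=> //.
- by move=> x; left.
- move=> x y b [[-> ->]|[i [d [ox Sxy]]]]; first by left.
  have [_ Ai _ _] := ox.
  by right; exists i, d; split; [exact: okS ox Sxy|exact: (signed_sym (seS _ Ai) Sxy)].
(* Composing two signs of one pair forth and back reduces uniqueness to a point paired with
   itself. *)
- suff irr x b : S' x x b -> b = false.
    move=> x y b c Sb Sc; have Sc' : S' y x c.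
      case: Sc => [[-> ->]|[i [d [ox Sxy]]]]; first by left.
      have [_ Ai _ _] := ox.
      by right; exists i, d; split; [exact: okS ox Sxy|exact: (signed_sym (seS _ Ai) Sxy)].
    by have /irr := S'trans _ _ _ _ _ Sb Sc'; case: (b); case: (c).
  move=> [[_ ->]//|[i [d [[_ Ai _ _] Sxx]]]].
  exact: (signed_fun (seS _ Ai) Sxx (signed_refl (seS _ Ai) x)).
(* Any relation in use at [x] has its index below [x], so a single closure point above [x] bounds
   all the classes of [x] at once. *)
- move=> x; have [d xd Dd] := unbD x; exists d => y [b [[<- _]//|[i [d' [ox Sxy]]]]].
  have [Dd' Ai hi dx] := ox.
  apply: (Dclass d i x y b) => //; apply: (wo_lt_le wo) hi _.
  exact: (wo_trans wo) dx (wo_ltW wo xd).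
Qed.

(** Write the signs of [S] as the coboundary of [z]. On the hull of [S], [G] and the graph of [s],
    the coboundaries of [z] and of [z] twisted by [w] both extend [S], as [w] is constant on its
    classes. They disagree wherever [s] changes [w]. *)
Lemma signed_split S (G : K -> K -> Prop) : signed_equivalence S ->
  (forall x, order_bounded (G x)) -> (forall y, order_bounded (G^~ y)) ->
  exists (S0 S1 : signed_rel) (s : K -> K),
  [/\ signed_equivalence S0 /\ signed_equivalence S1,
      (forall x y b, S x y b -> S0 x y b /\ S1 x y b),
      (forall x y, G x y -> (exists b, S0 x y b) /\ exists b, S1 x y b),
      involutive s &
      forall x, exists y b, [/\ r x y, r x (s y), S0 y (s y) b & S1 y (s y) (~~ b)]].
Proof.
move=> seS bG bG'; have [Sr Ss St Sf Sb] := seS.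
pose E x y := exists b, S x y b.
have Er x : E x x by exists false.
have Es x y : E x y -> E y x by move=> [b xy]; exists b; exact: Ss.
have Et x y z : E x y -> E y z -> E x z.
  by move=> [b xy] [c yz]; exists (b (+) c); exact: St xy yz.
have [w [s [wE sK sP]]] := equivalence_splitting wo initial regular infinK Er Es Et Sb.
have [z zS] := signed_trivialization seS.
pose R x y := E x y \/ (G x y \/ y = s x).
have [| |E' [RE' Er' Es' Et' bE']] := @equivalence_hull _ _ wo initial regular infinK uncK R.
- move=> x; apply: (@order_boundedS _ r _ (E x `|` (G x `|` [set s x]))).
    by move=> y [|[|->]]; [left|right; left|right; right].
  apply: order_boundedU => //; first exact: Sb.
  by apply: order_boundedU => //; exact: order_bounded1.
- move=> y; apply: (@order_boundedS _ r _ (E y `|` ([set x | G x y] `|` [set s y]))).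
    by move=> x [/Es|[Gxy|->]]; [left|right; left|right; right; rewrite /= sK].
  apply: order_boundedU => //; first exact: Sb.
  by apply: order_boundedU => //; [exact: bG'|]; exact: order_bounded1.
pose T (v : K -> bool) x y b := E' x y /\ b = v x (+) v y.
have seT v : signed_equivalence (T v).
  split.
  - by move=> x; split; rewrite ?addbb.
  - by move=> x y b [xy ->]; split; [exact: Es'|rewrite addbC].
  - move=> x y t b c [xy ->] [yt ->]; split; first exact: Et' xy yt.
    by rewrite -addbA (addbA (v y)) addbb.
  - by move=> x y b c [_ ->] [_ ->].
  - by move=> x; apply: order_boundedS (bE' x) => y [b []].
exists (T z), (T (fun x => z x (+) w x)), s; split=> //.
- move=> x y b Sxy; have xy : E x y by exists b.
  split; split; try by apply: RE'; left.
    exact: zS.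
  by rewrite (zS _ _ _ Sxy) (wE _ _ xy) addbACA addbb addbF.
- move=> x y Gxy; split; eexists; (split; [by apply: RE'; right; left|by []]).
- move=> x; have [y [xy xsy wy]] := sP x.
  exists y, (z y (+) z (s y)); split=> //; split=> //; try by apply: RE'; right; right.
  rewrite /= addbACA; have -> : w y (+) w (s y) by case: (w y) (w (s y)) wy => -[].
  by rewrite addbT.
Qed.

(** * The binary tree of coherent signed equivalences *)

Section Tree.
Variables (W : Type) (rW : rel W).
Hypothesis woW : well_order rW.
Hypothesis smallW : forall d, [set x | ~~ rW d x] #<= [set: K].
Variable G : W -> K -> K -> Prop.
Hypothesis G_bounded : forall d x, order_bounded (G d x).
Hypothesis G_bounded' : forall d y, order_bounded ((G d)^~ y).

Definition coherent_below d (S : W -> signed_rel) :=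
  (forall x, ~~ rW d x -> signed_equivalence (S x)) /\
  (forall x y, ~~ rW d x -> ~~ rW d y ->
    almost_subrel (S x) (S y) \/ almost_subrel (S y) (S x)).

Definition branching d (S : W -> signed_rel) (p : bool -> signed_rel) :=
  [/\ forall t, signed_equivalence (p t),
      forall t x, ~~ rW d x -> almost_subrel (S x) (p t),
      forall t x y, G d x y -> exists b, p t x y b &
      exists2 s : K -> K, involutive s &
      forall t x, exists y b, [/\ r x y, r x (s y), p t y (s y) b & p (~~ t) y (s y) (~~ b)]].

(** The predecessors of [d] inject into [K], so the earlier stages amalgamate into one signed
    equivalence, which is then split so as to absorb [G d]. *)
Lemma exists_branching d S : coherent_below d S -> exists p, branching d S p.
Proof.
move=> [seS cS]; have [k _] := infinite_setN0 infinK.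
have [h [_ hinj]] := card_le_ex k (smallW d).
have [S' [seS' SS']] := signed_amalgam hinj seS cS.
have [S0 [S1 [s [[se0 se1] SS0 GS sK sP]]]] := signed_split seS' (@G_bounded d) (@G_bounded' d).
have ext T : (forall x y b, S' x y b -> T x y b) -> forall x, ~~ rW d x -> almost_subrel (S x) T.
  by move=> ST x /SS'[a h']; exists a => u v b ? ? ?; apply: ST; exact: h'.
exists (fun t => if t then S1 else S0); split.
- by case.
- by case; apply: ext => x y b /SS0[].
- by case=> x y /GS[].
exists s => // -[] x; have [y [b [xy xsy y0 y1]]] := sP x; exists y.
  by exists (~~ b); split; rewrite ?negbK.
by exists b.
Qed.

(** By recursion along [W], with [f d] selecting one of the two extensions offered at stage [d]. Two
    branches have the same stages below their first difference, hence the same two extensions to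
    choose from there, and they choose opposite ones. *)
Lemma coherent_tree : exists S : (W -> bool) -> W -> signed_rel,
  [/\ forall f d, signed_equivalence (S f d),
      forall f c d, rW c d -> almost_subrel (S f c) (S f d),
      forall f d x y, G d x y -> exists b, S f d x y b &
      forall f g, f <> g -> exists d, exists2 s : K -> K, involutive s &
        forall x, exists y b, [/\ r x y, r x (s y), S f d y (s y) b & S g d y (s y) (~~ b)]].
Proof.
(* A default value, for incoherent data and for indices that are not below the current stage. *)
pose dummy : signed_rel := fun _ _ _ => Logic.True.
have /choice[step stepP] (q : W * (W -> signed_rel)) : exists p,
    coherent_below q.1 q.2 -> branching q.1 q.2 p.
  have [/exists_branching[p pP]|nc] := pselect (coherent_below q.1 q.2); first by exists p.
  by exists (fun _ => dummy).
pose cut d (S : W -> signed_rel) x := if ~~ rW d x then S x else dummy.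
pose F (f : W -> bool) d (rec : forall x, ~~ rW d x -> signed_rel) :=
  step (d, fun x => if pselect (~~ rW d x) is left h then rec x h else dummy) (f d).
pose S f := Fix (wo_lt_wf woW) (fun _ => signed_rel) (F f).
have SE f d : S f d = step (d, cut d (S f)) (f d).
  rewrite /S Fix_eq.
    rewrite {1}/F; congr (step (_, _) _); apply/funext => x; rewrite /cut.
    by case: pselect => [->//|/negP]; rewrite negbK => ->.
  move=> x g g' gg'; congr (F f x _); apply/functional_extensionality_dep => y.
  exact/functional_extensionality_dep.
have cutE d T x : ~~ rW d x -> cut d T x = T x by rewrite /cut => ->.
(* Branching at the earlier stages is what makes them coherent, and coherence is what yields
   branching at [d]; hence a single induction. *)
have SP f d : branching d (cut d (S f)) (step (d, cut d (S f))).
  elim/(well_founded_ind (wo_lt_wf woW)): d => d IH.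
  apply: (stepP (d, cut d (S f))); split=> /= [x xd|x y xd yd].
    by rewrite cutE// SE; have [] := IH x xd.
  rewrite !cutE//.
  have lt a b : a <> b -> ~~ rW b a -> ~~ rW d b -> almost_subrel (S f a) (S f b).
    move=> ab nba bd; rewrite (SE f b); have [_ + _ _] := IH b bd.
    by move=> /(_ (f b) a nba); rewrite cutE.
  have [->|xy] := pselect (x = y); first by left; exact: almost_subrel_refl.
  have [xley|] := boolP (rW x y); last by right; apply: lt => // /esym.
  left; apply: lt => //; apply/negP => yx; apply: xy.
  by apply: (wo_anti woW); rewrite xley.
exists S; split.
- by move=> f d; rewrite SE; have [] := SP f d.
- move=> f c d cd; have [dc|dc] := boolP (rW d c).
    by rewrite (@wo_anti _ _ woW c d) ?cd//; exact: almost_subrel_refl.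
  by rewrite (SE f d); have [_ /(_ (f d) c dc) + _ _] := SP f d; rewrite cutE.
- by move=> f d x y; rewrite SE; have [_ _ + _] := SP f d; apply.
- move=> f g fg; have [d fgd ld] : exists2 d, f d <> g d &
      forall y, f y <> g y -> rW d y.
    apply: (wo_least woW); apply: contrapT => nfg; apply: fg; apply/funext => x.
    by apply: contrapT => fgx; apply: nfg; exists x.
  have Sfg x : ~~ rW d x -> S f x = S g x.
    elim/(well_founded_ind (wo_lt_wf woW)): x => x IH xd.
    rewrite !SE; have -> : f x = g x by apply: contrapT => /ld; exact/negP.
    congr (step (_, _) _); apply/funext => y; rewrite /cut; case: ifP => // yx.
    by apply: IH => //; exact: (wo_lt_le woW) yx (wo_ltW woW xd).
  have cfg : cut d (S f) = cut d (S g).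
    by apply/funext => y; rewrite /cut; case: ifP => // /Sfg.
  exists d; have [_ _ _ [s sK sP]] := SP f d; exists s => // x.
  have [y [b [xy xsy yf yg]]] := sP (f d) x; exists y, b; rewrite !SE -cfg.
  by have -> : g d = ~~ f d by case: (f d) (g d) fgd => -[].
Qed.

End Tree.

End SignedRelations.

Import Order.TTheory GRing.Theory Num.Theory.
Import numFieldNormedType.Exports.
Local Open Scope ring_scope.

(** * Hilbert spaces *)

Section HilbertSpace.
Variables (R : realType) (H : completeNormedModType R[i]).
Variable dot : {dot H for Num.conj}.
Hypothesis norm_dot : forall x : H, `|x| ^+ 2 = dot x x.

Lemma dotC x y : dot x y = (dot y x)^*.
Proof. by rewrite (hermC dot) expr0 mul1r. Qed.

Lemma dotZl a x y : dot (a *: x) y = a * dot x y.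
Proof. exact: linearZl_LR. Qed.

Lemma dotZr a x y : dot x (a *: y) = a^* * dot x y.
Proof. exact: linearZr_LR. Qed.

Lemma dotDl x y z : dot (x + y) z = dot x z + dot y z.
Proof. exact: linearDl. Qed.

Lemma dotBl x y z : dot (x - y) z = dot x z - dot y z.
Proof. exact: linearBl. Qed.

Lemma dotBr x y z : dot x (y - z) = dot x y - dot x z.
Proof. exact: linearBr. Qed.

Lemma dot0l y : dot 0 y = 0.
Proof. exact: linear0l. Qed.

Lemma dot_suml I (s : seq I) (F : I -> H) y :
  dot (\sum_(i <- s) F i) y = \sum_(i <- s) dot (F i) y.
Proof. exact: linear_sumlz. Qed.

Lemma norm_orthD x y : dot x y = 0 -> `|x + y| ^+ 2 = `|x| ^+ 2 + `|y| ^+ 2.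
Proof. by move=> xy; rewrite !norm_dot (hnormDd (form := dot)). Qed.

Lemma cauchy_schwarz x y : `|dot x y| <= `|x| * `|y|.
Proof.
have [->|y0] := eqVneq y 0; first by rewrite linear0r !normr0 mulr0.
have d0 : dot y y != 0 by rewrite dnorm_eq0.
set t := dot x y / dot y y; set u := x - t *: y.
have uy : dot u (t *: y) = 0.
  by rewrite dotZr dotBl dotZl divfK// subrr mulr0.
have xE : x = u + t *: y by rewrite subrK.
have tx : `|t| * `|y| <= `|x|.
  rewrite -normrZ -ler_sqr ?nnegrE// [in leRHS]xE norm_orthD//.
  by rewrite lerDr exprn_ge0.
have -> : dot x y = t * `|y| ^+ 2 by rewrite norm_dot divfK.
by rewrite normrM normrX normr_id expr2 mulrA ler_wpM2r.
Qed.

Section Orthonormal.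
Variable B : set H.
Hypothesis onB : orthonormal_set dot B.

Lemma orthonormal_norm x : B x -> `|x| = 1.
Proof.
move=> Bx; have := norm_dot x; rewrite onB// eqxx => /eqP.
by rewrite sqrf_eq1 => /orP[/eqP//|/eqP e]; have := normr_ge0 x; rewrite e oppr_ge0 ler10.
Qed.

Lemma dot_sum (s : seq H) c b : uniq s -> (forall x, x \in s -> B x) -> B b ->
  dot (\sum_(x <- s) c x *: x) b = if b \in s then c b else 0.
Proof.
move=> us sB Bb; rewrite dot_suml.
rewrite (eq_big_seq (fun x => if x == b then c b else 0)) => [|x xs]; last first.
  by rewrite dotZl onB//; [case: eqP => [->|_]; rewrite ?mulr1 ?mulr0|exact: sB].
case: ifP => bs; last first.
  by rewrite big1_seq// => x /andP[_ xs]; case: eqP => // xb; rewrite -xb xs in bs.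
by rewrite (bigD1_seq b)//= eqxx big1 ?addr0// => x /negPf->.
Qed.

Lemma norm_sum (s : seq H) c : uniq s -> (forall x, x \in s -> B x) ->
  `|\sum_(x <- s) c x *: x| ^+ 2 = \sum_(x <- s) `|c x| ^+ 2.
Proof.
move=> us sB; rewrite norm_dot dot_suml.
apply: eq_big_seq => x xs; rewrite dotZl (dotC x) dot_sum ?xs ?normCK//; exact: sB.
Qed.

Lemma bessel (s : seq H) v : uniq s -> (forall x, x \in s -> B x) ->
  \sum_(x <- s) `|dot v x| ^+ 2 <= `|v| ^+ 2.
Proof.
move=> us sB; set w := \sum_(x <- s) dot v x *: x.
have vw : dot (v - w) w = 0.
  rewrite dotC {2}/w dot_suml big1_seq ?rmorph0// => x /andP[_ xs].
  have Bx := sB x xs.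
  by rewrite dotZl (dotC x) dotBl dot_sum// xs subrr rmorph0 mulr0.
by rewrite -norm_sum// -[in leRHS](subrK w v) norm_orthD// lerDr exprn_ge0.
Qed.

(** The support is the union of the sets [N n]. Each is finite: more than [|v|^2 (n + 1)] of its
    elements would violate Bessel's inequality. *)
Lemma countable_support v : countable [set b | B b /\ dot v b != 0].
Proof.
pose N n := [set b | B b /\ n.+1%:R^-1 <= `|dot v b| ^+ 2].
apply: (@sub_countable _ _ _ (\bigcup_n N n)).
  apply: subset_card_le => b [Bb b0].
  have : 0 < complex.Re (`|dot v b| ^+ 2).
    by rewrite -ltcR RRe_real ?realX ?normr_real// exprn_gt0// normr_gt0.
  move=> /ltr_add_invr[n]; rewrite add0r => nb; exists n => //; split=> //.
  rewrite -[leRHS]RRe_real ?realX ?normr_real//.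
  by have := ltW nb; rewrite -lecR fmorphV rmorph_nat.
apply: bigcup_countable => // n _; apply: finite_set_countable.
apply: contrapT => infN.
have : (complex.Re (`|v| ^+ 2) * n.+1%:R) < (Num.bound (complex.Re (`|v| ^+ 2) * n.+1%:R))%:R.
  apply: archi_boundP; rewrite mulr_ge0// -lecR RRe_real ?realX ?normr_real//.
  exact: exprn_ge0.
set m := Num.bound _; apply/negP; rewrite -leNgt -ler_pdivrMr//.
have [F FN mF] := infinite_set_fset m infN.
rewrite -lecR RRe_real ?realX ?normr_real//.
have FB x : x \in enum_fset F -> B x by move=> /FN[].
apply: le_trans (bessel v (fset_uniq F) FB).
apply: (@le_trans _ _ (\sum_(x <- enum_fset F) n.+1%:R^-1)).
  rewrite big_const_seq count_predT iter_addr_0 -[leRHS]mulr_natl.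
  rewrite rmorphM/= fmorphV !rmorph_nat ler_wpM2r ?invr_ge0//.
  by rewrite ler_nat.
by rewrite big_seq [leRHS]big_seq; apply: ler_sum => x /FN[].
Qed.

(** The finite subsets of [B] directed by inclusion, as a filter; convergence along it is unordered
    summation. *)
Let fam : set_system {fset H} :=
  filter_from [set F0 : {fset H} | forall x, x \in F0 -> B x]
    (fun F0 => [set F | (F0 `<=` F)%fset /\ forall x, x \in F -> B x]).

Let fam_proper : ProperFilter fam.
Proof.
eapply filter_from_proper; last by move=> F0 F0B; exists F0; split.
apply: filter_from_filter; first by exists fset0 => x; rewrite inE.
move=> F1 F2 F1B F2B; exists (F1 `|` F2)%fset.
  by move=> x; rewrite inE => /orP[/F1B|/F2B].
by move=> F [+ FB]; rewrite fsubUset => /andP[h1 h2]; split; split.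
Qed.

(** The partial sums form a Cauchy net, since the sums of squares are bounded: once a finite set
    nearly attains their supremum, further terms add little to the norm. Completeness gives the
    limit. *)
Lemma riesz_fischer (c : H -> R[i]) (M : R[i]) : 0 <= M ->
  (forall s : seq H, uniq s -> (forall x, x \in s -> B x) ->
    \sum_(x <- s) `|c x| ^+ 2 <= M ^+ 2) ->
  exists v, [/\ closure (lspan B) v, `|v| <= M & forall b, B b -> dot v b = c b].
Proof.
move=> M0 cM.
pose s (F : {fset H}) := \sum_(x <- F) c x *: x.
pose a (F : {fset H}) := \sum_(x <- F) `|c x| ^+ 2.
have sD F0 F : (F0 `<=` F)%fset -> (forall x, x \in F -> B x) ->
    `|s F - s F0| ^+ 2 = a F - a F0.
  move=> F0F FB; have p : perm_eq F (enum_fset F0 ++ enum_fset (F `\` F0)%fset).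
    apply: uniq_perm; first exact: fset_uniq.
      rewrite cat_uniq !fset_uniq andbT/=; apply/hasPn => x /=.
      by rewrite inE => /andP[].
    move=> x; rewrite mem_cat inE; case: (boolP (x \in F0)) => //= xF0.
    by rewrite (fsubsetP F0F).
  rewrite /s /a !(perm_big _ p)/= !big_cat/= ![_ + \sum_(_ <- (_ `\` _)%fset) _]addrC !addrK.
  by apply: norm_sum; [exact: fset_uniq|move=> x; rewrite inE => /andP[_ /FB]].
have aR F : (complex.Re (a F))%:C%C = a F.
  by rewrite RRe_real// ger0_real// sumr_ge0// => x _; rewrite exprn_ge0.
(* Suprema exist in [R] and not in [R[i]], hence the passage to real parts. *)
pose E := [set complex.Re (a F) | F in [set F : {fset H} | forall x, x \in F -> B x]].
have supE : has_sup E.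
  split; first by exists (complex.Re (a fset0)), fset0 => // x; rewrite inE.
  exists (complex.Re (M ^+ 2)) => _ [F FB <-].
  rewrite -lecR aR RRe_real ?realX ?ger0_real//.
  by apply: cM => //; exact: fset_uniq.
have small (e : R[i]) : 0 < e -> exists2 F0 : {fset H}, (forall x, x \in F0 -> B x) &
    forall F, (F0 `<=` F)%fset -> (forall x, x \in F -> B x) -> `|s F - s F0| < e.
  move=> e0; have e2 : 0 < complex.Re (e ^+ 2).
    by rewrite -ltcR RRe_real ?realX ?gtr0_real// exprn_gt0.
  have [_ [F0 F0B <-] h] := sup_adherent e2 supE.
  exists F0 => // F F0F FB; rewrite -ltr_sqr ?nnegrE// ?(ltW e0)// sD//.
  rewrite ltrBlDr -aR -(aR F0) -[e ^+ 2]RRe_real ?realX ?gtr0_real// -rmorphD ltcR.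
  rewrite -ltrBlDl; apply: le_lt_trans h; rewrite lerB//.
  by apply: sup_upper_bound => //; exists F.
have sfam_proper : ProperFilter (s @ fam) by exact: fmap_proper_filter.
have : cauchy (s @ fam).
  apply: cauchy_exP => e e0; have [F0 F0B h] := small e e0.
  exists (s F0); exists F0 => // F [F0F FB] /=.
  by rewrite -ball_normE/= distrC; exact: h.
move=> /cauchy_cvg/cvg_ex[v sv].
have near (e : R[i]) (F0 : {fset H}) : 0 < e -> (forall x, x \in F0 -> B x) ->
    exists F, [/\ (F0 `<=` F)%fset, forall x, x \in F -> B x & `|v - s F| < e].
  move=> e0 F0B; have [F1 F1B h] : (s @ fam) (ball v e) by apply: sv; exact: nbhsx_ballx.
  exists (F0 `|` F1)%fset.
  have FB x : x \in (F0 `|` F1)%fset -> B x by rewrite inE => /orP[/F0B|/F1B].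
  split=> //; first exact: fsubsetUl.
  have := h (F0 `|` F1)%fset; rewrite -ball_normE/=; apply; split=> //.
  exact: fsubsetUr.
exists v; split.
- move=> U /nbhs_ballP[e e0 eU]; have [||F [_ FB vF]] := near e fset0 => //.
  exists (s F); split; last by apply: eU; rewrite -ball_normE.
  by exists (enum_fset F), c; split.
- apply/ler_addgt0Pr => e e0; have [||F [_ FB vF]] := near e fset0 => //.
  rewrite -(subrK (s F) v) addrC (le_trans (ler_normD _ _))// lerD// ?(ltW vF)//.
  by rewrite -ler_sqr ?nnegrE// norm_sum// ?cM//; exact: fset_uniq.
- move=> b Bb; apply/eqP; rewrite -subr_eq0 -normr_le0.
  apply/ler_addgt0Pr => e e0; rewrite add0r.
  have [||F [bF FB vF]] := near e [fset b]%fset => //.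
    by move=> x; rewrite inE => /eqP->.
  rewrite fsub1set in bF.
  have -> : c b = dot (s F) b by rewrite /s dot_sum ?bF//; exact: fset_uniq.
  rewrite -dotBl (le_trans (cauchy_schwarz _ _))// (orthonormal_norm Bb) mulr1.
  exact: ltW.
Qed.

End Orthonormal.

Lemma lipschitz_closure_eq0 (A : set H) (f : H -> R[i]) (L : R[i]) : 0 <= L ->
  (forall x y, `|f x - f y| <= L * `|x - y|) -> (forall x, A x -> f x = 0) ->
  forall x, closure A x -> f x = 0.
Proof.
move=> L0 fL fA x Ax; apply/eqP; rewrite -normr_le0; apply/ler_addgt0Pr => e e0; rewrite add0r.
(* The radius is divided by [L + 1] since [L] may be zero. *)
have L1 : 0 < L + 1 by rewrite ltr_wpDl.
have [y [Ay]] := Ax _ (nbhsx_ballx x (e / (L + 1)) (divr_gt0 e0 L1)).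
rewrite -ball_normE/= => xy; rewrite -[f x]subr0 -(fA y Ay) (le_trans (fL _ _))//.
apply: (@le_trans _ _ ((L + 1) * `|x - y|)); first by rewrite ler_wpM2r// lerDl.
by rewrite mulrC -ler_pdivlMr// ltW.
Qed.

Lemma dot_closure_eq0 (A : set H) v : (forall x, A x -> dot v x = 0) ->
  forall x, closure A x -> dot v x = 0.
Proof.
apply: (@lipschitz_closure_eq0 _ _ `|v|) => // x y.
by rewrite -dotBr; exact: cauchy_schwarz.
Qed.

Lemma dot_lspan_eq0 (B : set H) v : (forall x, B x -> dot v x = 0) ->
  forall x, closure (lspan B) x -> dot v x = 0.
Proof.
move=> vB; apply: dot_closure_eq0 => x [s [c [sB ->]]].
rewrite dotC dot_suml big1_seq ?rmorph0// => y /andP[_ ys].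
by rewrite dotZl dotC vB ?rmorph0 ?mulr0//; exact: sB.
Qed.

Lemma dot_eq0 v : dot v v = 0 -> v = 0.
Proof. by move/eqP; rewrite dnorm_eq0 => /eqP. Qed.

End HilbertSpace.

(** * Operators built from coordinates, and adjoints *)

Section Operators.
Variables (R : realType) (H : completeNormedModType R[i]).
Variable dot : {dot H for Num.conj}.
Hypothesis norm_dot : forall x : H, `|x| ^+ 2 = dot x x.

Lemma bop_subE (S T : bop H) x : (S - T) x = S x - T x.
Proof. by []. Qed.

Lemma bop_mulE (S T : bop H) x : (S * T) x = S (T x).
Proof. by []. Qed.

Lemma bopD (T : bop H) x y : T (x + y) = T x + T y.
Proof. by have := bop_linear T 1 x y; rewrite !scale1r. Qed.

Lemma bop0 (T : bop H) : T 0 = 0.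
Proof. by apply: (addrI (T 0)); rewrite -bopD !addr0. Qed.

Lemma bopZ (T : bop H) a x : T (a *: x) = a *: T x.
Proof. by have := bop_linear T a x 0; rewrite bop0 !addr0. Qed.

Lemma bop_sum (T : bop H) I (s : seq I) (F : I -> H) :
  T (\sum_(i <- s) F i) = \sum_(i <- s) T (F i).
Proof. exact: (big_morph T (bopD T) (bop0 T)). Qed.

Variables (K : Type) (e : K -> H).
Hypothesis e_inj : injective e.
Hypothesis e_on : orthonormal_set dot (range e).
Hypothesis e_full : forall x, closure (lspan (range e)) x.

Lemma coord_ext v w : (forall k, dot v (e k) = dot w (e k)) -> v = w.
Proof.
move=> vw; apply/eqP; rewrite -subr_eq0; apply/eqP/(@dot_eq0 _ _ dot).
apply: (dot_lspan_eq0 norm_dot (B := range e)) => // _ [k _ <-].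
by rewrite dotBl vw subrr.
Qed.

Lemma dotr_ext v w : (forall x, dot x v = dot x w) -> v = w.
Proof. by move=> vw; apply: coord_ext => k; rewrite dotC vw -dotC. Qed.

(** With [s] the identity this gives the diagonal sign unitaries, and with trivial signs and an
    involution [s] the permutation operators. The coordinates are square summable, with norm at most
    that of [v], by Bessel's inequality and injectivity of [s]. *)
Lemma exists_weighted_shift (s : K -> K) (z : K -> bool) : injective s ->
  exists T : bop H, forall v k, dot (T v) (e k) = (-1) ^+ z k * dot v (e (s k)).
Proof.
move=> sinj; have [[k0]|K0] := pselect (inhabited K); last first.
  by exists 0 => v k; case: K0.
have /choice[g gP] (x : H) : exists k, (exists j, e j = x) -> e k = x.
  have [[j <-]|nx] := pselect (exists j, e j = x); first by exists j.
  by exists k0 => /nx.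
have gK k : g (e k) = k by apply: e_inj; apply: gP; exists k.
have /choice[f fP] v : exists w, `|w| <= `|v| /\
    forall k, dot w (e k) = (-1) ^+ z k * dot v (e (s k)).
  have [|w [_ wv wE]] := riesz_fischer norm_dot e_on
      (c := fun x => (-1) ^+ z (g x) * dot v (e (s (g x)))) (normr_ge0 v); last first.
    by exists w; split=> // k; rewrite wE ?gK//; exists k.
  move=> t ut tB; pose h x := e (s (g x)).
  rewrite (eq_bigr (fun x => `|dot v (h x)| ^+ 2)) => [|x _]; last first.
    by rewrite normrM normrX normrN1 expr1n mul1r.
  rewrite -(big_map h predT (fun y => `|dot v y| ^+ 2)); apply: (bessel norm_dot e_on).
    rewrite map_inj_in_uniq// => x y /tB[j _ <-] /tB[k _ <-].
    by rewrite /h !gK => /e_inj/sinj->.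
  by move=> x /mapP[y _ ->]; exists (s (g y)).
have bf : bounded_linear f.
  apply/asboolP; split; last by exists 1 => x; rewrite mul1r; have [] := fP x.
  move=> a u v; apply: coord_ext => k; have [_ E] := fP (a *: u + v).
  have [_ Eu] := fP u; have [_ Ev] := fP v.
  by rewrite E !dotDl !dotZl Eu Ev mulrDr mulrCA.
by exists (Bop bf) => v k /=; have [] := fP v.
Qed.

(** The value of the adjoint at [y] is built by Riesz-Fischer from the coefficients [dot y (T x)] at
    basis vectors [x]. The defining identity then passes from the basis to all vectors by linearity
    and density. *)
Lemma exists_adjoint (T : bop H) : exists S : bop H, forall x y, dot (T x) y = dot x (S y).
Proof.
have [M M0 TM] := bop_bounded T.
have /choice[f fP] y : exists w, `|w| <= M * `|y| /\ forall x, dot w x = dot y (T x).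
  have My : 0 <= M * `|y| by rewrite mulr_ge0.
  have [|w [_ wv wE]] := riesz_fischer norm_dot e_on (c := fun x => dot y (T x)) My.
    move=> s us sB; set c := fun x => dot y (T x).
    rewrite -(norm_sum norm_dot e_on c us sB); set w := \sum_(x <- s) _.
    rewrite ler_sqr ?nnegrE//; have [->|w0] := eqVneq w 0; first by rewrite normr0.
    rewrite -(ler_pM2r (_ : 0 < `|w|)) ?normr_gt0// -expr2.
    (* Testing [T] on the vector [w] with these very coefficients gives the bound after division by
       the norm of [w]. *)
    have -> : `|w| ^+ 2 = `|dot y (T w)|.
      rewrite -[LHS]ger0_norm ?exprn_ge0// (norm_sum norm_dot e_on c us sB).
      rewrite /w bop_sum dotC dot_suml; congr `|_|; rewrite rmorph_sum/=.
      apply: eq_bigr => x _.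
      by rewrite bopZ dotZl rmorphM/= -dotC normCK mulrC.
    apply: le_trans (cauchy_schwarz norm_dot _ _) _.
    by rewrite [M * _]mulrC -mulrA ler_wpM2l.
  exists w; split=> // x; apply/eqP; rewrite -subr_eq0; apply/eqP.
  pose h x := dot w x - dot y (T x).
  apply: (@lipschitz_closure_eq0 _ _ (lspan (range e)) h (`|w| + `|y| * M)) => //.
  - by rewrite addr_ge0// mulr_ge0.
  - move=> u v; have -> : h u - h v = dot w (u - v) - dot y (T (u - v)).
      have -> : T (u - v) = T u - T v.
        by rewrite -scaleN1r bopD bopZ scaleN1r.
      by rewrite !dotBr /h; ring.
    rewrite mulrDl (le_trans (ler_normB _ _))// lerD//.
      exact: cauchy_schwarz.
    rewrite (le_trans (cauchy_schwarz norm_dot _ _))// -mulrA ler_wpM2l//.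
  - move=> _ [s [c [sB ->]]]; rewrite /h bop_sum dotC [dot y _]dotC !dot_suml.
    apply/eqP; rewrite subr_eq0; apply/eqP; congr (_^*); apply: eq_big_seq => u us.
    by rewrite bopZ !dotZl dotC [dot (T u) _]dotC wE//; exact: sB.
have bf : bounded_linear f.
  apply/asboolP; split; last by exists M => x; have [] := fP x.
  move=> a u v; apply: coord_ext => k.
  have [_ E] := fP (a *: u + v); have [_ Eu] := fP u; have [_ Ev] := fP v.
  by rewrite E !dotDl !dotZl Eu Ev.
by exists (Bop bf) => x y; have [_ fy] := fP y; rewrite [RHS]dotC/= fy -dotC.
Qed.

Lemma adjointP (T : bop H) x y : dot (T x) y = dot x (adjoint dot T y).
Proof.
exact: (@xgetPex _ 0 [set S : bop H | forall x y, dot (T x) y = dot x (S y)]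
  (exists_adjoint T)).
Qed.

Lemma adjoint_unique (S T : bop H) : (forall x y, dot (T x) y = dot x (S y)) ->
  adjoint dot T = S.
Proof. by move=> TS; apply: bopP => y; apply: dotr_ext => x; rewrite -adjointP TS. Qed.

End Operators.

(** * The ideal of operators with small range *)

Section ClosedSubspace.
Variables (R : realType) (H : completeNormedModType R[i]).
Variable dot : {dot H for Num.conj}.
Hypothesis norm_dot : forall x : H, `|x| ^+ 2 = dot x x.

Lemma closure_linear (A : set H) :
  (forall a x y, A x -> A y -> A (a *: x + y)) ->
  forall a x y, closure A x -> closure A y -> closure A (a *: x + y).
Proof.
move=> Al a x y Ax Ay U /nbhs_ballP[e e0 eU].
have a1 : 0 < `|a| + 1 by rewrite ltr_wpDl.
have e2 : 0 < e / 2 by rewrite divr_gt0.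
have [x' [Ax']] := Ax _ (nbhsx_ballx x _ (divr_gt0 e2 a1)).
have [y' [Ay']] := Ay _ (nbhsx_ballx y _ e2).
rewrite -!ball_normE/= => yy' xx'.
exists (a *: x' + y'); split; first exact: Al.
apply: eU; rewrite -ball_normE/= opprD addrACA -scalerBr.
rewrite (le_lt_trans (ler_normD _ _))// (splitr e) ltr_leD ?(ltW yy')// normrZ.
apply: (@le_lt_trans _ _ ((`|a| + 1) * `|x - x'|)); first by rewrite ler_wpM2r// lerDl.
by rewrite mulrC -ltr_pdivlMr.
Qed.

Lemma lspan_subset (A B : set H) : A 0 ->
  (forall a x y, A x -> A y -> A (a *: x + y)) -> B `<=` A -> lspan B `<=` A.
Proof.
move=> A0 Al BA _ [s [c [sB ->]]]; elim: s sB => [|x s IH] sB; first by rewrite big_nil.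
rewrite big_cons; apply: Al; first by apply/BA/sB; rewrite mem_head.
by apply: IH => y ys; apply: sB; rewrite in_cons ys orbT.
Qed.

(** Take a maximal orthonormal subset [B] of [V]. If [v] differs from its projection [w] onto the
    closed span of [B], which lies in [V], then the normalised difference could be added to [B]. *)
Lemma exists_orthonormal_basis (V : set H) : closed V -> V 0 ->
  (forall a x y, V x -> V y -> V (a *: x + y)) ->
  exists B, orthonormal_basis dot V B.
Proof.
move=> cV V0 Vl.
have [F FP tF|B [[BV onB] maxB]] :=
    @Zorn_bigcup _ (fun B => B `<=` V /\ orthonormal_set dot B).
  split=> [x [B /FP[BV _] /BV]//|x y [B FB Bx] [B' FB' B'y]].
  have [BB'|B'B] := tF _ _ FB FB'.
    by have [_] := FP _ FB'; apply=> //; exact: BB'.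
  by have [_] := FP _ FB; apply=> //; exact: B'B.
exists B; split=> // v Vv.
have [|w [Bw _ wE]] := riesz_fischer norm_dot onB (c := dot v) (normr_ge0 v).
  by move=> s us sB; exact: (bessel norm_dot onB).
have [|vw] := eqVneq (v - w) 0; first by move=> /eqP; rewrite subr_eq0 => /eqP->.
have Vw : V w.
  rewrite (closure_id V).1//; apply: closureS Bw; exact: lspan_subset.
have Vu : V (v - w) by rewrite addrC -scaleN1r; exact: Vl.
pose b := `|v - w|^-1 *: (v - w).
have Vb : V b by rewrite -[b]addr0; exact: Vl.
have bB x : B x -> dot b x = 0 by move=> Bx; rewrite dotZl dotBl wE// subrr mulr0.
have bb : dot b b = 1.
  by rewrite -norm_dot normrZ normfV normr_id mulVf ?normr_eq0// expr1n.
exfalso; apply: (maxB (B `|` [set b])).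
  split=> [x|/(_ b) Bb]; first by left.
  have /bB : B b by apply: Bb; right.
  by rewrite bb => /eqP; rewrite oner_eq0.
have bNB x : B x -> (x == b) = false.
  by move=> Bx; apply/eqP => xb; move: bb; rewrite -{2}xb bB// => /esym/eqP; rewrite oner_eq0.
split=> [x [/BV//|->//]|x y [Bx|->] [By|->]].
- exact: onB.
- by rewrite dotC bB// rmorph0 bNB.
- by rewrite bB// eq_sym bNB.
- by rewrite bb eqxx.
Qed.

End ClosedSubspace.

Section Ideal.
Variables (R : realType) (H : completeNormedModType R[i]).
Variable dot : {dot H for Num.conj}.
Hypothesis norm_dot : forall x : H, `|x| ^+ 2 = dot x x.
Variables (K : Type) (r : rel K) (e : K -> H).
Hypothesis wo : well_order r.
Hypothesis initial : forall x, card_lt [set y | r y x /\ y <> x] [set: K].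
Hypothesis regular : forall A : set K, cofinal r A -> A #= [set: K].
Hypothesis infinK : infinite_set [set: K].
Hypothesis uncK : uncountable K.
Hypothesis e_inj : injective e.
Hypothesis e_on : orthonormal_set dot (range e).
Hypothesis e_full : forall x, closure (lspan (range e)) x.

Local Notation J := (small_ideal dot K).

Lemma bounded_support v : order_bounded r [set k | dot v (e k) != 0].
Proof.
apply: (small_bounded regular (countable_small uncK (countable_support norm_dot e_on v))).
apply: (card_le_inj (f := e)) => [k vk|x y _ _ /e_inj//]; by split=> //; exists k.
Qed.

Lemma bounded_support' v : order_bounded r [set k | dot (e k) v != 0].
Proof.
apply: order_boundedS (bounded_support v) => k /=.
by rewrite dotC fmorph_eq0.
Qed.

(** For the direct implication, fewer than [K] basis vectors of the closed range have jointly
    bounded support, which leaves the far rows zero. The converse is a counting argument with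
    countable supports. *)
Lemma small_ideal_rows (T : bop H) :
  J T <-> exists x, forall j, r x j -> forall v, dot (T v) (e j) = 0.
Proof.
split=> [[B [BV onB VB] [_ KB]]|[x xT]].
  have [x xP] : order_bounded r (\bigcup_(b in B) [set k | dot b (e k) != 0]).
    by apply: (bounded_bigcup wo regular infinK KB) => b _; exact: bounded_support.
  exists x => j xj v; rewrite dotC; apply/eqP; rewrite fmorph_eq0; apply/eqP.
  apply: (dot_lspan_eq0 norm_dot (B := B)); last first.
    by apply/VB/subset_closure; exists v.
  move=> b Bb; rewrite dotC; apply/eqP; rewrite fmorph_eq0.
  by apply: contrapT => /negP be; have /negP := xP j (ex_intro2 _ _ b Bb be).
have [|||B oB] := @exists_orthonormal_basis _ _ dot norm_dot (closure (range T)).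
- exact: closed_closure.
- by apply: subset_closure; exists 0; rewrite ?bop0.
- apply: closure_linear => a _ _ [u _ <-] [v _ <-]; exists (a *: u + v) => //.
  by rewrite bop_linear.
exists B => //; have [BV onB VB] := oB.
suff KB : ~ ([set: K] #<= B) by split=> //; have [] := card_le_total [set: K] B.
move=> /(card_le_ex 0)[h [hB hinj]].
have [a _] := infinite_setN0 infinK.
(* Every vector of the closed range is supported below [x], so each unit vector [h k] has a nonzero
   coordinate there. *)
have h0 k : exists2 j, ~~ r x j & dot (h k) (e j) != 0.
  apply: contrapT => nj; suff hk : h k = 0.
    by have := orthonormal_norm norm_dot onB (hB k I); rewrite hk normr0 => /eqP; rewrite eq_sym oner_eq0.
  apply: (coord_ext norm_dot e_full) => j; rewrite dot0l.
  have [xj|xj] := boolP (r x j); last by apply: contrapT => /eqP hj; apply: nj; exists j.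
  rewrite dotC; apply/eqP; rewrite fmorph_eq0; apply/eqP.
  apply: (dot_closure_eq0 norm_dot (A := range T)); last exact/BV/hB.
  by move=> _ [v _ <-]; rewrite dotC xT// rmorph0.
(* Each of the fewer than [K] indices below [x] meets only countably many of the [h k], so together
   they meet a bounded set of them, although [h0] says that they meet all. *)
have [y yP] : order_bounded r (\bigcup_(j in [set j | ~~ r x j]) [set k | dot (h k) (e j) != 0]).
  apply: (bounded_bigcup wo regular infinK).
    by apply: (bounded_card wo initial); exists x.
  move=> j _; have cj := countable_support norm_dot onB (e j).
  apply: (small_bounded regular (countable_small uncK cj)).
  apply: (card_le_inj (f := h)) => [k /= hk|k l _ _]; last exact: hinj.
  by split; [exact: hB|rewrite dotC fmorph_eq0].
have [j xj hj] := h0 y.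
have /negP := yP y (ex_intro2 _ _ j xj hj); apply; exact: wo_refl.
Qed.

(** Fewer than [K] rows remain, each of bounded support, so the far columns vanish as well; the
    converse is symmetric. The column form serves for left multiplication and for adjoints. *)
Lemma small_ideal_cols (T : bop H) :
  J T <-> exists x, forall j, r x j -> T (e j) = 0.
Proof.
pose A := adjoint dot T.
have AP x y : dot (T x) y = dot x (A y) by exact: (adjointP norm_dot e_on e_full).
split=> [/small_ideal_rows[x xT]|[x xT]].
  have [y yP] : order_bounded r (\bigcup_(j in [set j | ~~ r x j])
      [set k | dot (e k) (A (e j)) != 0]).
    apply: (bounded_bigcup wo regular infinK); last by move=> j _; exact: bounded_support'.
    by apply: (bounded_card wo initial); exists x.
  exists y => k yk; apply: (coord_ext norm_dot e_full) => j; rewrite dot0l.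
  have [/xT->//|xj] := boolP (r x j).
  rewrite AP; apply: contrapT => /eqP hj.
  by have := yP k (ex_intro2 _ _ j xj hj); rewrite yk.
have [y yP] : order_bounded r (\bigcup_(j in [set j | ~~ r x j])
    [set k | dot (T (e j)) (e k) != 0]).
  apply: (bounded_bigcup wo regular infinK); last by move=> j _; exact: bounded_support.
  by apply: (bounded_card wo initial); exists x.
apply/small_ideal_rows; exists y => k yk v; rewrite AP.
suff -> : A (e k) = 0 by rewrite dotC dot0l rmorph0.
apply: (coord_ext norm_dot e_full) => j; rewrite dot0l dotC -AP.
have [/xT->|xj] := boolP (r x j); first by rewrite dot0l rmorph0.
apply: contrapT => /eqP; rewrite fmorph_eq0 => hj.
by have := yP k (ex_intro2 _ _ j xj hj); rewrite yk.
Qed.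

Lemma small_ideal0 : J 0.
Proof.
apply/small_ideal_rows; have [x _] := infinite_setN0 infinK.
by exists x => j _ v; rewrite dot0l.
Qed.

Lemma small_idealB S T : J S -> J T -> J (S - T).
Proof.
move=> /small_ideal_rows[x xS] /small_ideal_rows[y yT]; apply/small_ideal_rows.
have [z [xz yz]] := wo_max2 wo x y; exists z => j zj v.
by rewrite bop_subE dotBl xS ?yT ?subrr//; exact: (wo_trans wo) zj.
Qed.

Lemma small_idealD S T : J S -> J T -> J (S + T).
Proof.
by move=> JS JT; rewrite -[T]opprK -[- T]sub0r; do 2 ?apply: small_idealB => //; exact: small_ideal0.
Qed.

Lemma small_idealZ a T : J T -> J (a *: T).
Proof.
move=> /small_ideal_rows[x xT]; apply/small_ideal_rows; exists x => j xj v.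
by rewrite dotZl xT// mulr0.
Qed.

Lemma small_idealMr S T : J S -> J (S * T).
Proof.
move=> /small_ideal_rows[x xS]; apply/small_ideal_rows; exists x => j xj v.
by rewrite bop_mulE xS.
Qed.

Lemma small_idealMl S T : J T -> J (S * T).
Proof.
move=> /small_ideal_cols[x xT]; apply/small_ideal_cols; exists x => j xj.
by rewrite bop_mulE xT// bop0.
Qed.

Lemma small_ideal_adjoint T : J T -> J (adjoint dot T).
Proof.
move=> /small_ideal_cols[x xT]; apply/small_ideal_rows; exists x => j xj v.
by rewrite dotC -(adjointP norm_dot e_on e_full) xT// dot0l rmorph0.
Qed.

(** The rows below [x] are fewer than [K] and have bounded supports, so beyond a further bound the
    columns vanish entirely. *)
Lemma small_ideal_entries (T : bop H) :
  (exists x, forall j k, r x j -> r x k -> dot (T (e k)) (e j) = 0) -> J T.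
Proof.
move=> [x xT]; apply/small_ideal_cols.
pose A := adjoint dot T.
have AP u v : dot (T u) v = dot u (A v) by exact: (adjointP norm_dot e_on e_full).
have [y yP] : order_bounded r (\bigcup_(j in [set j | ~~ r x j])
    [set k | dot (e k) (A (e j)) != 0]).
  apply: (bounded_bigcup wo regular infinK); last by move=> j _; exact: bounded_support'.
  by apply: (bounded_card wo initial); exists x.
have [z [xz yz]] := wo_max2 wo x y; exists z => k zk.
apply: (coord_ext norm_dot e_full) => j; rewrite dot0l.
have [xj|xj] := boolP (r x j); first by apply: xT => //; exact: (wo_trans wo) zk.
rewrite AP; apply: contrapT => /eqP hj.
have := yP k (ex_intro2 _ _ j xj hj); rewrite (wo_trans wo yz zk)//.
Qed.

End Ideal.

(** * Automorphisms of the quotient *)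

Section Automorphisms.
Variables (R : realType) (H : completeNormedModType R[i]).
Variable dot : {dot H for Num.conj}.
Hypothesis norm_dot : forall x : H, `|x| ^+ 2 = dot x x.
Variables (K : Type) (r : rel K) (e : K -> H).
Hypothesis wo : well_order r.
Hypothesis initial : forall x, card_lt [set y | r y x /\ y <> x] [set: K].
Hypothesis regular : forall A : set K, cofinal r A -> A #= [set: K].
Hypothesis infinK : infinite_set [set: K].
Hypothesis uncK : uncountable K.
Hypothesis e_inj : injective e.
Hypothesis e_on : orthonormal_set dot (range e).
Hypothesis e_full : forall x, closure (lspan (range e)) x.

Local Notation J := (small_ideal dot K).
Local Notation pi := (quot_pi J).
Local Notation adj := (adjoint dot).

Let JB := small_idealB norm_dot wo initial regular infinK uncK e_inj e_on e_full.
Let JD := small_idealD norm_dot wo initial regular infinK uncK e_inj e_on e_full.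
Let J0 := small_ideal0 norm_dot wo initial regular infinK uncK e_inj e_on e_full.
Let JZ := small_idealZ norm_dot wo initial regular infinK uncK e_inj e_on e_full.
Let JMl := small_idealMl norm_dot wo initial regular infinK uncK e_inj e_on e_full.
Let JMr := small_idealMr norm_dot wo initial regular infinK uncK e_inj e_on e_full.
Let Jadj := small_ideal_adjoint norm_dot wo initial regular infinK uncK e_inj e_on e_full.

Lemma quot_piP (S T : bop H) : pi S = pi T <-> J (S - T).
Proof.
split=> [/(congr1 (@quot_set _ _ _))/= ST|JST].
  have : coset J S S by rewrite /coset/= subrr; exact: J0.
  by rewrite ST.
have ST : coset J S = coset J T.
  apply/seteqP; split=> U /=; rewrite /coset/= => JU.
    by rewrite -[U](subrK S) -addrA; exact: JD.
  by rewrite -[U](subrK T) -addrA; apply: (JD) => //; rewrite -opprB -sub0r; exact: JB J0 JST.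
rewrite /quot_pi; move: (ex_intro2 _ _ _ _ _) (ex_intro2 _ _ _ _ _).
by rewrite ST => p q; congr Quot; exact: Prop_irrelevance.
Qed.

Lemma quot_pi_unlock (T : bop H) : (\pi_(quot J) T)%qT = pi T.
Proof. by rewrite unlock. Qed.

Lemma pi_repr (x : quot J) : pi (repr x) = x.
Proof. by rewrite -quot_pi_unlock reprK. Qed.

Lemma repr_pi (T : bop H) : J (repr (pi T) - T).
Proof. by apply/quot_piP; exact: pi_repr. Qed.

Lemma quot_addE (S T : bop H) : quot_add (pi S) (pi T) = pi (S + T).
Proof.
by rewrite /quot_add quot_pi_unlock; apply/quot_piP; rewrite opprD addrACA; apply: JD; exact: repr_pi.
Qed.

Lemma quot_scaleE a (T : bop H) : quot_scale a (pi T) = pi (a *: T).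
Proof.
rewrite /quot_scale quot_pi_unlock; apply/quot_piP; rewrite -scalerBr.
by apply: JZ; exact: repr_pi.
Qed.

Lemma quot_mulE (S T : bop H) : quot_mul (pi S) (pi T) = pi (S * T).
Proof.
rewrite /quot_mul quot_pi_unlock; apply/quot_piP; set S' := repr _; set T' := repr _.
have -> : S' * T' - S * T = (S' - S) * T' + S * (T' - T).
  by rewrite mulrBl mulrBr addrA subrK.
by apply: JD; [apply: JMr|apply: JMl]; exact: repr_pi.
Qed.

Let adjP := adjointP norm_dot e_on e_full.
Let adj_uniq := adjoint_unique norm_dot e_on e_full.

Lemma adjointB (S T : bop H) : adj (S - T) = adj S - adj T.
Proof. by apply: adj_uniq => x y; rewrite !bop_subE dotBl dotBr !adjP. Qed.

Lemma adjointM (S T : bop H) : adj (S * T) = adj T * adj S.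
Proof. by apply: adj_uniq => x y; rewrite !bop_mulE !adjP. Qed.

Lemma quot_starE (T : bop H) : quot_star dot (pi T) = pi (adj T).
Proof.
rewrite /quot_star quot_pi_unlock; apply/quot_piP; rewrite -adjointB.
by apply: Jadj; exact: repr_pi.
Qed.

Lemma exists_diagonal_sign : exists U : (K -> bool) -> bop H,
  forall z v k, dot (U z v) (e k) = (-1) ^+ z k * dot v (e k).
Proof.
have /choice[U UP] (z : K -> bool) : exists T : bop H, forall v k,
    dot (T v) (e k) = (-1) ^+ z k * dot v (e k).
  exact: (exists_weighted_shift norm_dot e_inj e_on e_full z (@inj_id K)).
by exists U => z; exact: UP.
Qed.

Section Conjugation.
Variable U : (K -> bool) -> bop H.
Hypothesis UE : forall z v k, dot (U z v) (e k) = (-1) ^+ z k * dot v (e k).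

Lemma diagonal_signK z : U z * U z = 1.
Proof.
apply: bopP => v; apply: (coord_ext norm_dot e_full) => k.
by rewrite bop_mulE !UE mulrA -expr2 sqrr_sign mul1r.
Qed.

Lemma diagonal_sign_basis z k : U z (e k) = (-1) ^+ z k *: e k.
Proof.
apply: (coord_ext norm_dot e_full) => j; rewrite UE dotZl.
have [->//|jk] := pselect (j = k).
rewrite [dot _ _]e_on; [|by exists k|by exists j].
by case: eqP => [/e_inj/esym//|_]; rewrite !mulr0.
Qed.

Lemma diagonal_sign_adjoint z : adj (U z) = U z.
Proof.
apply: bopP => y; apply: (coord_ext norm_dot e_full) => k.
rewrite dotC -adjP diagonal_sign_basis dotZl UE rmorphM/= -dotC; congr (_ * _).
by rewrite rmorph_sign.
Qed.

(** [U z] is its own inverse and its own adjoint, so this is conjugation by a unitary. *)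
Definition sign_conj z T := U z * T * U z.

Lemma sign_conj_entry z T j k : dot (sign_conj z T (e k)) (e j) =
  (-1) ^+ (z j (+) z k) * dot (T (e k)) (e j).
Proof.
by rewrite /sign_conj !bop_mulE UE diagonal_sign_basis bopZ dotZl signr_addb mulrA.
Qed.

Lemma sign_conjK z : involutive (sign_conj z).
Proof.
move=> T; rewrite /sign_conj !mulrA diagonal_signK mul1r -mulrA diagonal_signK.
by rewrite mulr1.
Qed.

Lemma sign_conjD z : {morph sign_conj z : S T / S + T}.
Proof. by move=> S T; rewrite /sign_conj mulrDr mulrDl. Qed.

Lemma sign_conjB z : {morph sign_conj z : S T / S - T}.
Proof. by move=> S T; rewrite /sign_conj mulrBr mulrBl. Qed.

Lemma sign_conjM z : {morph sign_conj z : S T / S * T}.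
Proof.
move=> S T; rewrite /sign_conj !mulrA; congr (_ * _ * _).
by rewrite -[in RHS]mulrA diagonal_signK mulr1.
Qed.

Lemma sign_conjZ z a : {morph sign_conj z : T / a *: T}.
Proof.
by move=> T; apply: bopP => v; rewrite /sign_conj !bop_mulE /= bopZ.
Qed.

Lemma sign_conj_adjoint z : {morph sign_conj z : T / adj T}.
Proof. by move=> T; rewrite /sign_conj !adjointM diagonal_sign_adjoint mulrA. Qed.

Lemma sign_conj_ideal z T : J T -> J (sign_conj z T).
Proof. by move=> JT; apply/JMr/JMl. Qed.

Section Limit.
Variables (W : Type) (rW : rel W).
Hypothesis woW : well_order rW.
Variables (h : bop H -> W) (z : W -> K -> bool).
Hypothesis stable : forall T d, rW (h T) d ->
  J (sign_conj (z d) T - sign_conj (z (h T)) T).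

(** By [stable], any stage after [h (repr x)] gives the same coset. *)
Definition limit_automorphism (x : quot J) : quot J :=
  pi (sign_conj (z (h (repr x))) (repr x)).
Local Notation phi := limit_automorphism.

(** The threshold is that of the representative of [pi T], which differs from [T] by an element of
    the ideal, and sign conjugations preserve the ideal. *)
Lemma limit_automorphismE T : exists c, forall d, rW c d ->
  phi (pi T) = pi (sign_conj (z d) T).
Proof.
exists (h (repr (pi T))) => d cd.
apply: (@eq_trans _ _ (pi (sign_conj (z d) (repr (pi T))))).
  by apply/esym/quot_piP; exact: stable.
by apply/quot_piP; rewrite -sign_conjB; apply: sign_conj_ideal; exact: repr_pi.
Qed.

Lemma limit_automorphismE2 S T : exists d,
  phi (pi S) = pi (sign_conj (z d) S) /\ phi (pi T) = pi (sign_conj (z d) T).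
Proof.
have [[c cP] [c' cP']] := (limit_automorphismE S, limit_automorphismE T).
by have [d [cd cd']] := wo_max2 woW c c'; exists d; split; [exact: cP|exact: cP'].
Qed.

Lemma limit_automorphismE3 S T V : exists d, [/\ phi (pi S) = pi (sign_conj (z d) S),
  phi (pi T) = pi (sign_conj (z d) T) & phi (pi V) = pi (sign_conj (z d) V)].
Proof.
have [c cP] := limit_automorphismE S; have [c' cP'] := limit_automorphismE T.
have [c2 cP2] := limit_automorphismE V.
have [a [ca ca']] := wo_max2 woW c c'; have [d [ad cd]] := wo_max2 woW a c2.
exists d; split; [apply: cP|apply: cP'|exact: cP2]; exact: (wo_trans woW) ad.
Qed.

(** Each identity involves finitely many cosets, on which the map acts, at a common late stage, as
    conjugation by one unitary. The map is its own inverse because each sign conjugation is. *)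
Lemma limit_automorphism_star : star_automorphism dot phi.
Proof.
split.
- apply: (@inv_bij _ phi) => x; rewrite -(pi_repr x); set T := repr x.
  have [c cP] := limit_automorphismE T.
  pose T' := sign_conj (z c) T; have TT' : phi (pi T) = pi T' by apply: cP; exact: wo_refl.
  have [c' cP'] := limit_automorphismE T'.
  have [d [cd cd']] := wo_max2 woW c c'.
  rewrite TT' (cP' d)//; apply: (@eq_trans _ _ (pi (sign_conj (z d) (sign_conj (z d) T)))).
    apply/quot_piP; rewrite -sign_conjB; apply: sign_conj_ideal; apply/quot_piP.
    by rewrite -TT' -cP.
  by rewrite sign_conjK.
- move=> x y; rewrite -(pi_repr x) -(pi_repr y) quot_addE.
  have [d [-> -> ->]] := limit_automorphismE3 (repr x) (repr y) (repr x + repr y).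
  by rewrite quot_addE sign_conjD.
- move=> a x; rewrite -(pi_repr x) quot_scaleE.
  have [d [-> ->]] := limit_automorphismE2 (repr x) (a *: repr x).
  by rewrite quot_scaleE sign_conjZ.
- move=> x y; rewrite -(pi_repr x) -(pi_repr y) quot_mulE.
  have [d [-> -> ->]] := limit_automorphismE3 (repr x) (repr y) (repr x * repr y).
  by rewrite quot_mulE sign_conjM.
- move=> x; rewrite -(pi_repr x) quot_starE.
  have [d [-> ->]] := limit_automorphismE2 (repr x) (adj (repr x)).
  by rewrite quot_starE sign_conj_adjoint.
Qed.

End Limit.

End Conjugation.

End Automorphisms.

(** * Distinct automorphisms from distinct branches *)

Section TreeOfAutomorphisms.
Variables (R : realType) (H : completeNormedModType R[i]).
Variable dot : {dot H for Num.conj}.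
Hypothesis norm_dot : forall x : H, `|x| ^+ 2 = dot x x.
Variables (K : Type) (r : rel K) (e : K -> H).
Hypothesis wo : well_order r.
Hypothesis initial : forall x, card_lt [set y | r y x /\ y <> x] [set: K].
Hypothesis regular : forall A : set K, cofinal r A -> A #= [set: K].
Hypothesis infinK : infinite_set [set: K].
Hypothesis uncK : uncountable K.
Hypothesis e_inj : injective e.
Hypothesis e_on : orthonormal_set dot (range e).
Hypothesis e_full : forall x, closure (lspan (range e)) x.

Local Notation J := (small_ideal dot K).
Local Notation pi := (quot_pi J).
Local Notation adj := (adjoint dot).

Variables (W : Type) (rW : rel W).
Hypothesis woW : well_order rW.
Hypothesis smallW : forall d, [set x | ~~ rW d x] #<= [set: K].
Variable h : bop H -> W.
Hypothesis h_inj : injective h.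

Lemma exists_automorphism_tree : exists Phi : (W -> bool) -> quot J -> quot J,
  injective Phi /\ forall f, star_automorphism dot (Phi f).
Proof.
have [U UE] := exists_diagonal_sign norm_dot e_inj e_on e_full.
(* The matrix support of the operator with index [d], empty if there is none. Once absorbed at stage
   [d], the signs on it no longer change near infinity, which is the stability needed for a limit
   automorphism. *)
pose G d j k := exists2 T, h T = d & dot (T (e k)) (e j) != 0.
have adjP := adjointP norm_dot e_on e_full.
have bG d j : order_bounded r (G d j).
  have [[T hT]|nT] := pselect (exists T, h T = d); last first.
    have [x _] := infinite_setN0 infinK.
    by exists x => k [T hT]; case: nT; exists T.
  apply: (order_boundedS _ (bounded_support' norm_dot regular uncK e_inj e_on (adjoint dot T (e j)))).
  by move=> k [T' hT']; rewrite /= -adjP (h_inj (etrans hT (esym hT'))).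
have bG' d k : order_bounded r ((G d)^~ k).
  have [[T hT]|nT] := pselect (exists T, h T = d); last first.
    have [x _] := infinite_setN0 infinK.
    by exists x => j [T hT]; case: nT; exists T.
  apply: (order_boundedS _ (bounded_support norm_dot regular uncK e_inj e_on (T (e k)))).
  by move=> j [T' hT']; rewrite /= (h_inj (etrans hT (esym hT'))).
have [S [seS cS GS dS]] := coherent_tree wo initial regular infinK uncK woW smallW bG bG'.
have /choice[z zS] (f : W -> bool) : exists z, forall d x y b, S f d x y b -> b = z d x (+) z d y.
  have /choice[z zP] d := signed_trivialization (seS f d).
  by exists z => d; exact: zP.
have stable f T d : rW (h T) d ->
    J (sign_conj U (z f d) T - sign_conj U (z f (h T)) T).
  move=> Td; have [a aS] := cS f _ _ Td.
  apply: (small_ideal_entries norm_dot wo initial regular infinK uncK e_inj e_on e_full).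
  exists a => j k aj ak; rewrite bop_subE dotBl !(sign_conj_entry norm_dot e_inj e_on e_full UE)//.
  have [->|Tjk] := eqVneq (dot (T (e k)) (e j)) 0; first by rewrite !mulr0 subrr.
  have [b Sb] : exists b, S f (h T) j k b by apply: GS; exists T.
  by rewrite -(zS _ _ _ _ _ Sb) -(zS _ _ _ _ _ (aS _ _ _ aj ak Sb)) subrr.
exists (fun f => limit_automorphism U h (z f)); split; last first.
  move=> f; apply: (limit_automorphism_star norm_dot wo initial regular infinK uncK
    e_inj e_on e_full UE woW); exact: stable.
move=> f g; apply: contraPP => fg.
have [d [s sK sP]] := dS f g fg.
(* [T] is the permutation operator of the involution [s] on which the two branches disagree. *)
have [T TE] := exists_weighted_shift norm_dot e_inj e_on e_full (fun=> false) (inv_inj sK).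
have Ef := limit_automorphismE norm_dot wo initial regular infinK uncK e_inj e_on e_full (stable f) T.
have Eg := limit_automorphismE norm_dot wo initial regular infinK uncK e_inj e_on e_full (stable g) T.
move: Ef Eg => [c cP] [c' cP'].
have [c1 [cc1 c'c1]] := wo_max2 woW c c'; have [c2 [c12 dc2]] := wo_max2 woW c1 d.
move/(congr1 (fun phi => phi (quot_pi J T))).
rewrite (cP c2) ?(cP' c2); try exact: (wo_trans woW) c12.
move=> /(quot_piP norm_dot wo initial regular infinK uncK e_inj e_on e_full).
move=> /(small_ideal_rows norm_dot wo initial regular infinK uncK e_inj e_on e_full)[x xP].
have [a aS] := cS f _ _ dc2; have [a' aS'] := cS g _ _ dc2.
have [x1 [xx1 ax1]] := wo_max2 wo x a; have [x2 [x12 a'x2]] := wo_max2 wo x1 a'.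
have [y [b [xy xsy Sf Sg]]] := sP x2.
have le v w : r v x1 -> r x2 w -> r v w.
  by move=> vx xw; exact: (wo_trans wo) (wo_trans wo vx x12) xw.
(* At row [y] and column [s y], an entry 1 of [T], the two conjugates have opposite signs and so
   differ by 2 or -2. Such entries occur arbitrarily far out, so the difference is not in the
   ideal. *)
have := xP y (le _ _ xx1 xy) (e (s y)).
rewrite bop_subE dotBl !(sign_conj_entry norm_dot e_inj e_on e_full UE)// TE mul1r e_on; try by exists (s y).
rewrite eqxx !mulr1.
rewrite -(zS _ _ _ _ _ (aS _ _ _ (le _ _ ax1 xy) (le _ _ ax1 xsy) Sf)).
rewrite -(zS _ _ _ _ _ (aS' _ _ _ (wo_trans wo a'x2 xy) (wo_trans wo a'x2 xsy) Sg)).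
rewrite signrN opprK -mulr2n => /eqP; rewrite mulrn_eq0/=.
by rewrite signr_eq0.
Qed.

End TreeOfAutomorphisms.

(** * Counting *)

Lemma cantor_card T : ~ ([set: set T] #<= [set: T]).
Proof.
move=> /card_le_setTP[f finj].
pose D := [set x | exists2 A, f A = x & ~ A x].
have [DD|nDD] := pselect (D (f D)); last by apply: (nDD); exists D.
by have [A /finj-> nA] := DD; apply: nA.
Qed.

Lemma card_le_powerset T U : [set: T] #<= [set: U] -> [set: set T] #<= [set: set U].
Proof.
move=> /card_le_setTP[f finj]; apply/card_le_setTP; exists (fun A => f @` A) => A B AB.
apply/seteqP; split=> x Ax.
  by have [y By /finj<-] : (f @` B) (f x) by rewrite -AB; exists x.
by have [y By /finj<-] : (f @` A) (f x) by rewrite AB; exists x.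
Qed.

Lemma card_le_setX T T' U U' : [set: T] #<= [set: U] -> [set: T'] #<= [set: U'] ->
  [set: T * T'] #<= [set: U * U'].
Proof.
move=> /card_le_setTP[f finj] /card_le_setTP[g ginj]; apply/card_le_setTP.
by exists (fun p => (f p.1, g p.2)) => -[a b] [c d] /= [/finj-> /ginj->].
Qed.

Lemma card_countable_le (T : countType) U : infinite_set [set: U] ->
  [set: T] #<= [set: U].
Proof. by move=> /infiniteP; apply: card_le_trans; exact: countableP. Qed.

(** Two subsets of [T] are coded by one subset of [bool * T]. *)
Lemma card_powerset_square T : infinite_set [set: T] ->
  [set: set T * set T] #<= [set: set T].
Proof.
move=> infT; apply: (@card_le_trans _ _ _ [set: set (bool * T)]).
  apply/card_le_setTP; exists (fun p => [set q | if q.1 then p.1 q.2 else p.2 q.2]).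
  move=> [A B] [A' B'] /= E; congr (_, _).
    by apply/funext => x; exact: (congr1 (fun D => D (true, x)) E).
  by apply/funext => x; exact: (congr1 (fun D => D (false, x)) E).
apply: card_le_powerset; apply: card_le_trans (card_square infT).
by apply: card_le_setX => //; exact: card_countable_le.
Qed.

(* Index by pairs [(A, B)]: the set [D] is too small to meet every fibre over [B]. *)
Lemma card_powerset_setD W X (Phi : set W -> X) (D : set X) : infinite_set [set: W] ->
  injective Phi -> D #<= [set: W] -> [set: set W] #<= range Phi `\` D.
Proof.
move=> infW Pinj DW; have [w _] := infinite_setN0 infW.
have /card_le_setTP[j jinj] := card_powerset_square infW.
have [B BP] : exists B, forall A, ~ D (Phi (j (A, B))).
  apply: contrapT => nB.
  have /choice[a aD] B : exists A, D (Phi (j (A, B))).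
    by apply: contrapT => nA; apply: nB; exists B => A DA; apply: nA; exists A.
  apply: (@cantor_card W); apply: card_le_trans DW.
  by apply: (card_le_inj (f := fun B => Phi (j (a B, B)))) => // B B' _ _ /Pinj/jinj[].
apply: (card_le_inj (f := fun A => Phi (j (A, B)))) => [A _|A A' _ _ /Pinj/jinj[]//].
by split; [exists (j (A, B))|exact: BP].
Qed.

(** [W] is the set of points of a well-ordered [P] with at most [K] predecessors. If this is not all
    of [P], the predecessors of the least other point are in [W] and are more than [K] in number, so
    [P] embeds in them by minimality of the successor. *)
Lemma exists_successor_well_order (K P : Type) :
  (forall T : Type, card_lt [set: K] [set: T] -> [set: P] #<= [set: T]) ->
  exists (W : Type) (rW : rel W), [/\ well_order rW,
    forall d, [set x | ~~ rW d x] #<= [set: K],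
    [set: P] #<= [set: W] & [set: W] #<= [set: P]].
Proof.
move=> succP; have [rP wo] := well_ordering_principle {classic P}.
pose good (p : P) := [set q | ~~ rP p q] #<= [set: K].
exists {p : P | good p}, (fun x y => rP (sval x) (sval y)); split.
- move=> A [x Ax]; pose A' := [pred p | `[< exists2 y, y \in A & sval y = p >]].
  have [|_ [[/asboolP[y Ay <-] lb] uy]] := wo A'; first by exists (sval x); apply/asboolP; exists x.
  exists y; split.
    by split=> // t At; apply: lb; apply/asboolP; exists t.
  move=> t [At lbt]; suff: sval y = sval t.
    by case: y t {Ay lb uy At lbt} => p ? [q ?] /= pq; exact: eq_exist.
  apply: uy; split; first by apply/asboolP; exists t.
  by move=> _ /asboolP[u Au <-]; exact: lbt.
- move=> [d gd]; apply: (card_le_trans _ gd).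
  apply: (card_le_inj (f := sval)) => // -[p ?] [q ?] _ _ /= pq; exact: eq_exist.
- have [gT|/existsNP nT] := pselect (forall p, good p).
    by apply/card_le_setTP; exists (fun p => exist good p (gT p)) => p q [].
  have [p np lp] := wo_least wo nT.
  have [A1 A2] := card_le_set_type [set q | ~~ rP p q].
  apply: (@card_le_trans _ _ _ [set: {q | ~~ rP p q}]).
    apply: succP; split; last by move=> h; apply: np; exact: card_le_trans A1 h.
    apply: card_le_trans A1.
    by have [] := card_le_total [set: K] [set q | ~~ rP p q].
  have gq q : ~~ rP p q -> good q.
    by move=> pq; apply: contrapT => /lp h; rewrite h in pq.
  apply/card_le_setTP; exists (fun q => exist good (sval q) (gq _ (svalP q))).
  by move=> [q ?] [q' ?] /= [qq']; exact: eq_exist.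
- by apply/card_le_setTP; exists sval => -[p ?] [q ?] /= pq; exact: eq_exist.
Qed.

Section Counting.
Variables (R : realType) (H : completeNormedModType R[i]).
Variable dot : {dot H for Num.conj}.
Hypothesis norm_dot : forall x : H, `|x| ^+ 2 = dot x x.
Variables (K : Type) (e : K -> H).
Hypothesis infinK : infinite_set [set: K].
Hypothesis e_on : orthonormal_set dot (range e).
Hypothesis e_full : forall x, closure (lspan (range e)) x.

Lemma bop_entry_inj (S T : bop H) :
  (forall j k, dot (S (e k)) (e j) = dot (T (e k)) (e j)) -> S = T.
Proof.
move=> ST; apply: bopP => v; apply: (coord_ext norm_dot e_full) => j.
rewrite !(adjointP norm_dot e_on e_full) [LHS]dotC [RHS]dotC; congr (dot _ _)^*.
apply: (coord_ext norm_dot e_full) => k.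
by rewrite [LHS]dotC [RHS]dotC -!(adjointP norm_dot e_on e_full) ST.
Qed.

(** An operator is coded by the rational lower cuts of the real and imaginary parts of its matrix
    entries. *)
Lemma card_bop : [set: bop H] #<= [set: set K].
Proof.
apply: (@card_le_trans _ _ _ [set: set ((K * K) * (bool * rat))]); last first.
  apply: card_le_powerset; apply: card_le_trans (card_square infinK).
  by apply: card_le_setX; [exact: card_square|exact: card_countable_le].
pose part (b : bool) (x : R[i]) : R := if b then complex.Re x else complex.Im x.
apply/card_le_setTP; exists (fun T : bop H =>
  [set p | ratr p.2.2 < part p.2.1 (dot (T (e p.1.2)) (e p.1.1))]).
move=> S T ST; apply: bop_entry_inj => j k.
have part_le b (S' T' : bop H) :
    [set p | ratr p.2.2 < part p.2.1 (dot (S' (e p.1.2)) (e p.1.1))] =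
    [set p | ratr p.2.2 < part p.2.1 (dot (T' (e p.1.2)) (e p.1.1))] ->
    part b (dot (S' (e k)) (e j)) <= part b (dot (T' (e k)) (e j)).
  move=> E; rewrite leNgt; apply/negP => /rat_in_itvoo[q]; rewrite in_itv/= => /andP[Tq qS].
  have /= qT := congr1 (fun D : set _ => D ((j, k), (b, q))) E; move: qS; rewrite qT => qT'.
  by have := lt_trans Tq qT'; rewrite ltxx.
have partE b : part b (dot (S (e k)) (e j)) = part b (dot (T (e k)) (e j)).
  by apply/eqP; rewrite eq_le !part_le.
by apply/eqP; rewrite eq_complex; apply/andP; split; apply/eqP; [exact: (partE true)|exact: (partE false)].
Qed.

End Counting.

Theorem theorem1p1 (K Kplus : Type)
  (K_regular : regular_cardinal K) (K_uncountable : uncountable K)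
  (Kplus_succ : successor_cardinal K Kplus)
  (R : realType) (H : completeNormedModType R[i]) (dot : {dot H for Num.conj})
  (norm_dot : forall x : H, `|x| ^+ 2 = dot x x)
  (dim_H : hilbert_dim_eq dot [set: H] K)
  (pow_K : [set: set K] #= [set: Kplus]) :
  outer_automorphism dot (small_ideal dot K) #= [set: set Kplus].
Proof.
have [infinK [r [wo initial] regular]] := K_regular.
have [B [_ onB fullB] BK] := dim_H.
have /card_set_bijP[e [eB e_inj eonto]] : [set: K] #= B by rewrite card_eq_sym.
have rangeE : range e = B.
  by apply/seteqP; split=> [_ [k _ <-]|x /eonto//]; exact: eB.
have {}e_inj : injective e by move=> x y; apply: e_inj; rewrite inE.
have e_on : orthonormal_set dot (range e) by rewrite rangeE.
have e_full x : closure (lspan (range e)) x by rewrite rangeE; exact: fullB.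
have [W [rW [woW smallW PW WP]]] := exists_successor_well_order Kplus_succ.2.
(* The cardinal arithmetic hypothesis enters here; it allows each operator its own stage in [W]. *)
have bopP' : [set: bop H] #<= [set: Kplus].
  by rewrite -(card_le_eqr pow_K); exact: (card_bop norm_dot infinK e_on e_full).
have quotP' : [set: quot (small_ideal dot K)] #<= [set: Kplus].
  apply: card_le_trans bopP'; apply/card_le_setTP; exists repr.
  exact: (can_inj (@reprK _ (quot (small_ideal dot K)))).
have infP : infinite_set [set: Kplus].
  by move=> fP; apply: infinK; apply: card_le_finite fP; exact: Kplus_succ.1.1.
have infW : infinite_set [set: W] by move=> fW; apply: infP; exact: card_le_finite fW.
have /card_le_setTP[h h_inj] := card_le_trans bopP' PW.
have [Phi [Phi_inj Phi_star]] := exists_automorphism_tree norm_dot wo initial regular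
  infinK K_uncountable e_inj e_on e_full woW smallW h_inj.
pose inn : set (quot (small_ideal dot K) -> quot (small_ideal dot K)) := [set phi | inner dot phi].
(* An inner automorphism is determined by its unitary. *)
have innW : inn #<= [set: W].
  apply: card_le_trans (card_le_trans quotP' PW).
  have /choice[u uP] (phi : quot (small_ideal dot K) -> quot (small_ideal dot K)) :
      exists u, inn phi -> forall a, phi a = quot_mul (quot_mul u a) (quot_star dot u).
    have [[u _ uE]|ninn] := pselect (inn phi); first by exists u.
    by exists (quot_one (small_ideal dot K)) => /ninn.
  apply: (card_le_inj (f := u)) => // phi psi phiI psiI uu; apply/funext => a.
  by rewrite (uP phi)// (uP psi)// uu.
apply/card_eqPle; split.
  (* Upper bound: all self-maps of the quotient are counted, through their graphs. *)
  apply: card_le_trans (card_leT _) _.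
  apply: (@card_le_trans _ _ _ [set: set (quot (small_ideal dot K) * quot (small_ideal dot K))]).
    apply/card_le_setTP; exists (fun phi => [set p | phi p.1 = p.2]) => phi psi E.
    by apply/funext => x; have /= E' := congr1 (fun D : set _ => D (x, phi x)) E; apply/esym; rewrite -E'.
  by apply: card_le_powerset; apply: card_le_trans (card_square infP); exact: card_le_setX.
(* Lower bound: the branches are the subsets of [W], and removing the few inner automorphisms does
   not lower their number. *)
apply: card_le_trans (card_le_powerset PW) _.
have Phi'_inj : injective (fun A : set W => Phi (fun x => `[< A x >])).
  move=> A A' /Phi_inj E; apply/funext => x; apply/propext.
  have {}E : `[< A x >] = `[< A' x >] := congr1 (fun f => f x) E.
  by split=> /asboolP Ax; apply/asboolP; [rewrite -E|rewrite E].
apply: card_le_trans (card_powerset_setD infW Phi'_inj innW) _.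
by apply: subset_card_le => _ [[A _ <-] ninn]; split; [exact: Phi_star|].
Qed.
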